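(* For any integer $m\ge 1$, we have (i) $\mathbb{R}^{\mathbb{N}}/\ell_1\not\le_B\mathbb{R}^{\mathbb{N}}/\mathrm{cs}^{(m)}$, (ii) $\mathbb{R}^{\mathbb{N}}/c_0\not\le_B\mathbb{R}^{\mathbb{N}}/\mathrm{bv}_0^{(\infty)}$, (iii) $\mathbb{R}^{\mathbb{N}}/\mathrm{bv}_0^{(\infty)}<_B\mathbb{R}^{\mathbb{N}}/\ell_1\otimes\mathbb{R}^{\mathbb{N}}/c_0$.
   Context: $\mathbb{N}=\{0,1,2,\dots\}$; $c_0$ and $\ell_1$ are the sets of null, respectively absolutely summable, real sequences. For a linear subspace $L\subseteq\mathbb{R}^{\mathbb{N}}$, $\mathbb{R}^{\mathbb{N}}/L$ is the equivalence relation on $\mathbb{R}^{\mathbb{N}}$ in which $a,b$ are equivalent iff $a-b\in L$. For $m\ge1$, $\mathrm{cs}^{(m)}=\{a\in\mathbb{R}^{\mathbb{N}}:\sum_j a(mj+i-1)\text{ converges for each }1\le i\le m\}$. Fix a bijection $\langle\cdot,\cdot\rangle:\mathbb{N}^2\to\mathbb{N}$ such that for each $i$, $\langle i,j\rangle$ is strictly increasing in $j$. Then $\mathrm{bv}^{(\infty)}=\{a\in\mathbb{R}^{\mathbb{N}}:\sum_i\sum_j|a(\langle i,j\rangle)-a(\langle i,j+1\rangle)|<+\infty\}$ and $\mathrm{bv}_0^{(\infty)}=\mathrm{bv}^{(\infty)}\cap c_0$. For equivalence relations $E$ on $Z$ and $F$ on $W$, $E\otimes F$ is the equivalence relation on $Z\times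 W$ with $((z_1,w_1),(z_2,w_2))\in E\otimes F$ iff $(z_1,z_2)\in E$ and $(w_1,w_2)\in F$. For equivalence relations $E,F$ on Polish spaces $Z,W$, $E\le_B F$ means there is a Borel function $\theta:Z\to W$ with $(x,y)\in E\iff(\theta(x),\theta(y))\in F$ for all $x,y\in Z$; $E<_B F$ means $E\le_B F$ and not $F\le_B E$. *)

(* Defs.v *)
From mathcomp Require Import all_boot all_order all_algebra.
From mathcomp Require Import all_classical all_reals all_analysis.

Set Implicit Arguments.
Unset Strict Implicit.
Unset Printing Implicit Defensive.

Import Order.TTheory GRing.Theory Num.Theory.
Import numFieldNormedType.Exports.

Local Open Scope classical_set_scope.
Local Open Scope ring_scope.

Definition borel_function (Z W : topologicalType) (theta : Z -> W) : Prop :=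
  forall B : set W, <<s @open W >> B -> <<s @open Z >> (theta @^-1` B).

Definition borel_reducible (Z W : topologicalType)
    (E : Z -> Z -> Prop) (F : W -> W -> Prop) : Prop :=
  exists2 theta : Z -> W, borel_function theta &
    forall x y : Z, E x y <-> F (theta x) (theta y).

Definition strictly_borel_reducible (Z W : topologicalType)
    (E : Z -> Z -> Prop) (F : W -> W -> Prop) : Prop :=
  borel_reducible E F /\ ~ borel_reducible F E.

Definition prod_rel (Z W : Type) (E : Z -> Z -> Prop) (F : W -> W -> Prop) :
    Z * W -> Z * W -> Prop :=
  fun x y => E x.1 y.1 /\ F x.2 y.2.

Section sequence_spaces.
Variable R : realType.

(* The pointwise-convergence topology is the product topology, for which R^N is
   Polish. *)
Local Notation RN := {ptws nat -> R}.

(* The equivalence relation R^N/L. *)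
Definition coset_rel (L : set RN) : RN -> RN -> Prop :=
  fun a b => L (fun n => a n - b n).

Definition c0 : set RN := [set a | a n @[n --> \oo] --> (0 : R)].

Definition l1 : set RN := [set a | (\sum_(n <oo) `|a n|%:E < +oo)%E].

Definition cs (m : nat) : set RN :=
  [set a | forall i : nat, (1 <= i <= m)%N ->
     cvgn (series (fun j : nat => a (m * j + i - 1)%N))].

Definition admissible_pairing (pr : nat * nat -> nat) : Prop :=
  bijective pr /\
  forall i : nat, {homo (fun j : nat => pr (i, j)) : j k / (j < k)%N}.

Definition bv_infty (pr : nat * nat -> nat) : set RN :=
  [set a | (\sum_(i <oo) \sum_(j <oo)
              `|a (pr (i, j)) - a (pr (i, j.+1))|%:E < +oo)%E].

Definition bv0_infty (pr : nat * nat -> nat) : set RN :=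
  bv_infty pr `&` c0.

End sequence_spaces.

(* Main.v *)
Require Import Defs.
From mathcomp Require Import all_boot all_order all_algebra.
From mathcomp Require Import all_classical all_reals all_analysis.
From mathcomp Require Import zify ring lra.
Import numFieldNormedType.Exports.

(** Each non-reduction is proved by making a hypothetical reduction [theta]
continuous, and then nearly additive, on a suitable tree of points.

Letters n stand for the reals 1/n. On sequences of letters a Borel map is
continuous on a comeager set that is closed under finite modifications
([borel_generic_continuity]). A finite change of the argument changes the value
of [theta] by an element of the target space, and membership in the target space
is witnessed by an index T at which a closed condition on the tail starts to
hold. By Baire category one T works on a whole basic open set ([uniform_tail]).
Repeating this along a binary tree ([fusion]) yields points [x a] for
[a : nat -> bool] which choose freely between 0 and a prescribed 1/c k at the
k-th of a sequence of positions and agree elsewhere, together with windows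
[T k, T k.+1] in which [theta (x a) - theta (x b)] depends, up to an error of
order 2^-k, only on the k-th bits of a and b: flipping the k-th bit produces a
bump that lives in the k-th window.

For bv0 the bumps have costs V k, their variations, and the variation of
[theta (x a) - theta (x b)] is, up to a bounded error, the sum of the costs of the
bits that differ. Every letter is prescribed infinitely often. Some letter i has
finite total cost ([cheap_letter]). Flipping all the bits of this letter changes
[x a] by a sequence that is not null; but its image has bounded variation, and it
is a uniform limit, on every row, of images of finite changes, which are null. So
the image lies in bv0 ([bv_rows_c0]), a contradiction.

For cs the k-th bump has a total effect on the m series, a vector u k of R^m, and
an excursion, the largest partial sum inside the window. Excursions tend to 0 as
positions and letters tend to infinity ([small_excursions]). Since R^m has finite
dimension, among the many positions that carry one letter two have nearly the
same u ([twin_positions]). Take one pair of twins for each letter from some point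
on, and let a select the first and b the second members: the effects cancel in
pairs, so the image of [x a - x b] has convergent series, while the sum of the
absolute values of [x a - x b] exceeds a tail of the harmonic series.

The reduction of bv0 to the product sends a sequence to the pair of its jumps
along the rows and itself ([bv0_reducible]); it is strict because c0 reduces to
the second factor. *)

Set Implicit Arguments.
Unset Strict Implicit.
Unset Printing Implicit Defensive.

Import Order.TTheory GRing.Theory Num.Theory.

Local Open Scope classical_set_scope.

(** * Category in the space of sequences of letters *)

Definition cofinal (D : set (seq nat)) := forall u, exists v, D (u ++ v).

Definition generic_for (D : nat -> set (seq nat)) : set (nat -> nat) :=
  [set x | forall n, exists l, D n (mkseq x l)].

(** Comeager for the topology of pointwise convergence on sequences of discrete
letters: an open set is given by a set of finite strings, and is dense when that
set of strings is cofinal. *)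
Definition comeager (B : set (nat -> nat)) :=
  exists2 D, forall n, cofinal (D n) & generic_for D `<=` B.

(** Prefixing a string to a sequence; near the string [s] the space is a copy of
itself through [catx s]. *)
Definition catx (s : seq nat) (z : nat -> nat) (n : nat) : nat :=
  if (n < size s)%N then nth 0 s n else z (n - size s)%N.

Definition forced (s : seq nat) (B : set (nat -> nat)) :=
  comeager [set z | B (catx s z)].

Definition paste (s : seq nat) (x : nat -> nat) : nat -> nat :=
  catx s (fun n => x (size s + n)%N).

Lemma catx_cat s t z : catx (s ++ t) z = catx s (catx t z).
Proof.
apply/funext => n; rewrite /catx size_cat nth_cat.
case: (ltnP n (size s)) => ns; first by rewrite ltn_addr.
by rewrite -ltn_subLR // subnDA.
Qed.

Lemma mkseq_catx s z l : mkseq (catx s z) (size s + l) = s ++ mkseq z l.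
Proof.
rewrite /mkseq iotaD map_cat; congr (_ ++ _).
  apply: (@eq_from_nth _ 0); rewrite size_map size_iota // => i i_s.
  by rewrite (nth_map 0) ?size_iota // nth_iota // /catx add0n i_s.
rewrite add0n -{1}[size s]addn0 iotaDl -map_comp; apply: eq_map => i /=.
by rewrite /catx ltnNge leq_addr /= addKn.
Qed.

Lemma catx_mkseq (x : nat -> nat) l : catx (mkseq x l) (fun n => x (l + n)%N) = x.
Proof.
apply/funext => n; rewrite /catx size_mkseq.
by case: ltnP => nl; [rewrite nth_mkseq|rewrite subnKC].
Qed.

Lemma paste_paste p q x :
  paste p (paste q x) = paste (p ++ drop (size p) q) x.
Proof.
apply/funext => n; rewrite /paste /catx size_cat size_drop nth_cat nth_drop.
case: (ltnP n (size p)) => np; first by rewrite ltn_addr.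
rewrite subnKC //; case: (ltnP n (size q)) => nq.
  by rewrite subnKC ?(leq_trans np (ltnW nq)) // nq.
rewrite (_ : (n < _)%N = false); first by congr (x _); lia.
by apply/negbTE; rewrite -leqNgt; lia.
Qed.

Lemma paste_nil x : paste [::] x = x.
Proof. by apply/funext => n; rewrite /paste /catx /= subn0. Qed.

Lemma paste_catx p q z : size p = size q -> paste p (catx q z) = catx p z.
Proof.
move=> pq; apply/funext => n; rewrite /paste /catx -pq.
by case: ltnP => // np; rewrite ltnNge leq_addr /= addKn.
Qed.

(** A chain of longer and longer strings has a limit sequence. The index [n.+1]
is there because only the string [s n.+1] is sure to have an n-th letter. *)
Lemma string_limit (s : nat -> seq nat) :
    (forall k, prefix (s k) (s k.+1)) -> (forall k, (k <= size (s k))%N) ->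
  forall k, mkseq (fun n => nth 0 (s n.+1) n) (size (s k)) = s k.
Proof.
move=> s_pre s_size k.
have s_mono j d : prefix (s j) (s (j + d)%N).
  elim: d => [|d IHd]; first by rewrite addn0 prefix_refl.
  by rewrite addnS; apply: prefix_trans IHd (s_pre _).
have nth_pre j d i : (i < size (s j))%N -> nth 0 (s (j + d)%N) i = nth 0 (s j) i.
  by move=> ij; have /prefixP[t ->] := s_mono j d; rewrite nth_cat ij.
apply: (@eq_from_nth _ 0); rewrite size_mkseq // => i ik.
rewrite nth_mkseq //; case: (leqP k i.+1) => ki.
  by rewrite -(subnKC ki) nth_pre.
by rewrite -(subnKC (ltnW ki)) nth_pre //; exact: s_size.
Qed.

Lemma comeagerS B B' : B `<=` B' -> comeager B -> comeager B'.
Proof. by move=> BB' [D coD DB]; exists D => //; apply: subset_trans BB'. Qed.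

Lemma comeager_bigcap (I : countType) (B : I -> set (nat -> nat)) :
  (forall i, comeager (B i)) -> comeager [set x | forall i, B i x].
Proof.
move=> /(_ _)/cid2-/all_sig2[D coD DB].
exists (fun n => if unpickle n is Some (i, m) then D i m else setT) => [n|x gx i].
  by case: unpickle => [[i m]|]; [exact: coD|move=> u; exists [::]].
by apply: (DB i) => m; have := gx (pickle (i, m)); rewrite pickleK.
Qed.

(** The Baire category theorem: a point is built by extending a string into one
cofinal set after the other. *)
Lemma comeager_nonempty B : comeager B -> exists x, B x.
Proof.
move=> [D coD DB]; have [e eD] := choice (fun nu => coD nu.1 nu.2).
(* The letter 0 added at each step only makes the strings grow. *)
pose s := fix s k := if k is k'.+1 then rcons (s k' ++ e (k', s k')) 0 else [::].
have s_pre k : prefix (s k) (s k.+1).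
  by apply/prefixP; exists (rcons (e (k, s k)) 0); rewrite -rcons_cat.
have s_size k : (k <= size (s k))%N.
  by elim: k => //= k IHk; rewrite size_rcons size_cat ltnS (leq_trans IHk) ?leq_addr.
have lim := string_limit s_pre s_size.
exists (fun n => nth 0 (s n.+1) n); apply: DB => n.
exists (size (s n ++ e (n, s n))).
rewrite -[X in D n X](_ : take (size (s n ++ e (n, s n))) (s n.+1) = _).
  by rewrite /= -cats1 take_size_cat //; exact: (eD (n, s n)).
rewrite -(lim n.+1) /= size_rcons /mkseq -map_take take_iota.
by rewrite (minn_idPl _).
Qed.

Lemma comeager_forced s B : comeager B -> forced s B.
Proof.
move=> [D coD DB]; exists (fun n => [set w | D n (s ++ w)]) => [n u|z gz].
  by have [v Dv] := coD n (s ++ u); exists v; rewrite /= catA.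
apply: DB => n; have [l Dl] := gz n.
by exists (size s + l)%N; rewrite mkseq_catx.
Qed.

(** As there are countably many strings, this makes it possible to shrink a
comeager set to one that is closed under finite modifications. *)
Lemma comeager_paste p B : comeager B -> comeager [set x | B (paste p x)].
Proof.
move=> [D coD DB].
exists (fun n => [set w | (size p <= size w)%N /\ D n (p ++ drop (size p) w)]).
  move=> n u; have [v Dv] := coD n (p ++ drop (size p) (u ++ nseq (size p) 0)).
  exists (nseq (size p) 0 ++ v); split; first by rewrite !size_cat size_nseq; lia.
  rewrite catA drop_cat size_cat size_nseq.
  rewrite (_ : (_ < _)%N = ((0 < size u)%N)); last by lia.
  case: u Dv => [|a u] /= Dv; last by rewrite catA.
  by move: Dv; rewrite drop_oversize ?size_nseq // cats0 add0n subnn drop0.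
move=> x gx; apply: DB => n; have [l [pl Dl]] := gx n.
exists l; rewrite size_mkseq in pl.
rewrite /paste -{1}(subnKC pl) mkseq_catx.
suff <- : drop (size p) (mkseq x l) = mkseq (fun n => x (size p + n)%N) (l - size p)
  by [].
by rewrite /mkseq -map_drop drop_iota add0n -{1}[size p]addn0 iotaDl -map_comp.
Qed.

Lemma forced_ext u B :
  forced u B -> comeager [set x | forall z, x = catx u z -> B x].
Proof.
move=> [D coD DB].
exists (fun n => [set w | (size u <= size w)%N /\
                          (take (size u) w = u -> D n (drop (size u) w))]).
  move=> n w; pose w' := w ++ nseq (size u) 0.
  have uw' : (size u <= size w')%N by rewrite size_cat size_nseq leq_addl.
  have [v Dv] := coD n (drop (size u) w').
  exists (nseq (size u) 0 ++ v); rewrite catA -/w'; split.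
    by rewrite size_cat (leq_trans uw') ?leq_addr.
  move=> _; have [lt|ge] := ltnP (size u) (size w').
    by rewrite drop_cat lt.
  have eq : size u = size w' by apply/eqP; rewrite eqn_leq uw'.
  by rewrite eq drop_size_cat //; move: Dv; rewrite eq drop_size.
move=> x gx z xz; rewrite xz; apply: DB => n; have [l [ul Dl]] := gx n.
rewrite size_mkseq in ul; exists (l - size u)%N.
have := Dl; rewrite xz -(subnKC ul) mkseq_catx take_size_cat // drop_size_cat //.
by rewrite addKn; exact.
Qed.

(** A set that is comeager near a dense set of strings is comeager: the local
witnesses are glued along the shortest prefix at which one is available, so that
they do not interfere. *)
Lemma forced_local B : (forall u, exists v, forced (u ++ v) B) -> comeager B.
Proof.
move=> locB.
have : forall t, exists D, (forall n, cofinal (D n)) /\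
    (forced t B -> generic_for D `<=` [set z | B (catx t z)]).
  move=> t; have [[D coD DB]|nt] := pselect (forced t B); first by exists D.
  by exists (fun=> setT); split => // n u; exists [::].
move=> /choice[D] /all_and2[coD DB].
(* [first w l]: the shortest prefix of w that forces B has length l. *)
pose first (w : seq nat) l := [/\ (l <= size w)%N, forced (take l w) B &
   forall j, (j < l)%N -> ~ forced (take j w) B].
have first_ext w v l : first w l -> first (w ++ v) l.
  move=> [lw fl nl]; split; first by rewrite size_cat (leq_trans lw) ?leq_addr.
    by rewrite takel_cat.
  move=> j jl; rewrite takel_cat; first exact: nl.
  exact: leq_trans (ltnW jl) lw.
have first_ex w : forced w B -> exists l, first w l.
  move=> fw; have ex : exists l, `[< (l <= size w)%N /\ forced (take l w) B >].
    by exists (size w); apply/asboolP; rewrite take_size.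
  have [l /asboolP[lw fl] min_l] := ex_minnP ex; exists l; split => // j jl fj.
  suff : (l <= j)%N by rewrite leqNgt jl.
  by apply: min_l; apply/asboolP; split=> //; apply: leq_trans (ltnW jl) lw.
exists (fun n => [set w | exists2 l, first w l & D (take l w) n (drop l w)]).
  move=> n u; have [v fv] := locB u; have [l fl] := first_ex _ fv.
  have [w Dw] := coD (take l (u ++ v)) n (drop l (u ++ v)).
  exists (v ++ w); rewrite catA; exists l; first exact: first_ext.
  have [luv _ _] := fl; rewrite takel_cat // drop_cat.
  have [//|ge] := ltnP l (size (u ++ v)).
  have eq : l = size (u ++ v) by apply/eqP; rewrite eqn_leq luv ge.
  by move: Dw; rewrite eq subnn drop0 drop_size.
move=> x gx.
have take_mk l L : (l <= L)%N -> take l (mkseq x L) = mkseq x l.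
  by move=> lL; rewrite /mkseq -map_take take_iota (minn_idPl lL).
have [L0 [l0 [l0L fl0 nl0] _]] := gx 0.
rewrite size_mkseq in l0L; rewrite take_mk // in fl0.
rewrite -(catx_mkseq x l0); apply: (DB _ fl0) => n.
have [L [l [lL fl nl] Dl]] := gx n.
rewrite size_mkseq in lL; rewrite take_mk // in fl.
have ll0 : l = l0.
  apply/eqP; rewrite eqn_leq; apply/andP; split; rewrite leqNgt; apply/negP => h.
    apply: (nl _ h); rewrite take_mk //; exact: leq_trans (ltnW h) lL.
  apply: (nl0 _ h); rewrite take_mk //; exact: leq_trans (ltnW h) l0L.
exists (L - l0)%N; rewrite ll0 in lL Dl; move: Dl; rewrite take_mk //.
suff -> : drop l0 (mkseq x L) = mkseq (fun n => x (l0 + n)%N) (L - l0) by [].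
by rewrite /mkseq -map_drop drop_iota add0n -{1}[l0]addn0 iotaDl -map_comp.
Qed.

(** * Sets with the Baire property *)

(** This is the Baire property: densely many strings decide whether the set is
comeager or meager below them. *)
Definition decided (B : set (nat -> nat)) :=
  forall s, exists t, forced (s ++ t) B \/ forced (s ++ t) (~` B).

Lemma decidedC B : decided B -> decided (~` B).
Proof.
move=> dB s; have [t [f|f]] := dB s; exists t; [right|left] => //.
by rewrite setCK.
Qed.

(** Below a string that admits no extension forcing one of the sets, each
complement is forced densely, hence everywhere, hence so is their intersection. *)
Lemma decided_cover (B : nat -> set (nat -> nat)) s :
    (forall n, decided (B n)) ->
  (exists t n, forced (s ++ t) (B n)) \/ forced s (~` \bigcup_n B n).
Proof.
move=> dB; have [[t [n f]]|no] := pselect (exists t n, forced (s ++ t) (B n)).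
  by left; exists t, n.
right; have fC n : comeager [set z | (~` B n) (catx s z)].
  apply: forced_local => u; have [t [f|f]] := dB n (s ++ u).
    by case: no; exists (u ++ t), n; rewrite catA.
  exists t; apply: comeagerS f => z /=.
  by rewrite -catA catx_cat.
apply: comeagerS (comeager_bigcap fC) => z /= nz [n _ Bn]; exact: (nz n).
Qed.

Lemma decided_bigcup (B : nat -> set (nat -> nat)) :
  (forall n, decided (B n)) -> decided (\bigcup_n B n).
Proof.
move=> dB s; have [[t [n f]]|f] := decided_cover s dB.
  by exists t; left; apply: comeagerS f => z Bz; exists n.
by exists [::]; right; rewrite cats0.
Qed.

Lemma decided_cover_force (B : nat -> set (nat -> nat)) s :
    (forall n, decided (B n)) -> (forall x, exists n, B n x) ->
  exists t n, forced (s ++ t) (B n).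
Proof.
move=> dB cB; have [//|/comeager_nonempty[z /= nz]] := decided_cover s dB.
by case: nz; have [n Bn] := cB (catx s z); exists n.
Qed.

Lemma decided_open (B : set (nat -> nat)) :
    (forall x, B x -> exists l, forall z, B (catx (mkseq x l) z)) -> decided B.
Proof.
move=> oB s; have [[z Bz]|no] := pselect (exists z, B (catx s z)).
  have [l Bl] := oB _ Bz; exists (mkseq z l); left.
  exists (fun=> setT) => [n u|w _ /=]; first by exists [::].
  rewrite -mkseq_catx addnC.
  have -> : mkseq (catx s z) (l + size s) =
            mkseq (catx s z) l ++ mkseq (fun n => catx s z (l + n)%N) (size s).
    rewrite /mkseq iotaD map_cat; congr (_ ++ _).
    by rewrite add0n -{1}[l]addn0 iotaDl -map_comp.
  by rewrite catx_cat.
exists [::]; right; rewrite cats0.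
exists (fun=> setT) => [n u|w _ Bw]; first by exists [::].
by apply: no; exists w.
Qed.

Local Open Scope ring_scope.

Lemma comeager_hits (D : set (seq nat)) :
  cofinal D -> comeager [set x | exists l, D (mkseq x l)].
Proof. by move=> coD; exists (fun=> D) => // x /(_ 0%N). Qed.

Lemma comeagerI B B' : comeager B -> comeager B' -> comeager (B `&` B').
Proof.
move=> cB cB'; have c (b : bool) : comeager (if b then B else B') by case: b.
by apply: comeagerS (comeager_bigcap c) => x h; split; [apply: (h true)|apply: (h false)].
Qed.

(** * Borel functions are continuous on a comeager set *)

Section borel_category.
Variable R : realType.
Local Notation RN := {ptws nat -> R}.

(** The inverse of 0 is 0, so the letter 0 stands for 0. The alphabet is countable
so that there are countably many finite modifications, and it contains
arbitrarily small positive reals. *)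
Definition letters (x : nat -> nat) : RN := fun n => (x n)%:R^-1.

(** Sequences that share longer and longer prefixes converge pointwise, so open
sets of real sequences are open for discrete letters. *)
Lemma open_letters (U : set RN) x :
  open U -> U (letters x) -> exists l, forall z, U (letters (catx (mkseq x l) z)).
Proof.
move=> oU Ux; apply: contrapT => no.
have /choice[z nUz] l : exists z, ~ U (letters (catx (mkseq x l) z)).
  apply: contrapT => nz; apply: no; exists l => z.
  by apply: contrapT => nU; apply: nz; exists z.
pose y l : RN := letters (catx (mkseq x l) (z l)).
have : {ptws, y @ \oo --> letters x}.
  apply/pointwise_cvgP => n.
  have : (fun l => y l n) @ \oo --> letters x n; last exact.
  apply: cvg_near_cst; near=> l; rewrite /= /y /letters /catx size_mkseq.
  have nl : (n < l)%N by near: l; exact: nbhs_infty_gt.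
  by rewrite nl nth_mkseq.
move=> /(_ U (open_nbhs_nbhs (conj oU Ux))) [N _ NU].
by apply: (nUz N); apply: (NU N) => /=.
Unshelve. all: by end_near. Qed.

Lemma borel_decided (B : set RN) :
  <<s @open RN >> B -> decided [set x | B (letters x)].
Proof.
move=> sB; apply: (sB [set B | decided [set x | B (letters x)]]); split; first split.
- apply: decided_open => x [].
- by move=> A dA; rewrite setTD; exact: decidedC.
- move=> A dA; have := decided_bigcup dA.
  by congr decided; apply/seteqP; split=> x [n].
- by move=> U oU; apply: decided_open => x Ux; exact: open_letters.
Qed.

Lemma open_coordinate_ball n (q e : R) : open [set y : RN | `|y n - q| < e].
Proof.
have -> : [set y : RN | `|y n - q| < e] = (fun y : RN => y n) @^-1` (ball q e).
  by apply/seteqP; split => y; rewrite /= /ball /= distrC.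
apply: open_comp; last exact: ball_open.
by move=> y _; exact: (@proj_continuous _ (fun=> R) n).
Qed.

(** For every coordinate n and precision 1/(k+1), densely many strings force the
n-th coordinate of theta to be within this precision of some rational. A point is
good when it has prefixes of all these kinds and when what its prefixes force is
true at it; then theta is continuous on the good points. *)
Lemma borel_generic_continuity (theta : RN -> RN) : borel_function theta ->
  exists G, [/\ comeager G, forall p x, G x -> G (paste p x) &
    forall x n (e : R), 0 < e -> G x -> exists l, forall y, G y ->
      (forall i, (i < l)%N -> y i = x i) ->
      `|theta (letters y) n - theta (letters x) n| <= e].
Proof.
move=> borel.
pose near_val n k (q : rat) : set (nat -> nat) :=
  [set x | `|theta (letters x) n - ratr q| < k.+1%:R^-1].
have dec n k q : decided (near_val n k q).
  apply: (@borel_decided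
    (theta @^-1` [set y : RN | `|y n - ratr q| < k.+1%:R^-1])).
  by apply: borel; apply: sub_sigma_algebra; exact: open_coordinate_ball.
pose D n k : set (seq nat) := [set u | exists q, forced u (near_val n k q)].
have coD n k : cofinal (D n k).
  move=> u; have := @decided_cover_force
    (fun i => if unpickle i is Some q then near_val n k q else set0) u.
  case=> [i|x|t [i]].
  - by case: unpickle => [q|]; [exact: dec|apply: decided_open => x []].
  - have kpos : (0 : R) < k.+1%:R^-1 by rewrite invr_gt0.
    have lt : theta (letters x) n - k.+1%:R^-1 < theta (letters x) n + k.+1%:R^-1.
      by rewrite ltrD2l; apply: lt_trans kpos; rewrite oppr_lt0.
    have [q] := rat_in_itvoo lt.
    rewrite in_itv /= => /andP[q1 q2]; exists (pickle q); rewrite pickleK.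
    by rewrite /near_val /= ltr_distlC q1 q2.
  - case: unpickle => [q|] f; first by exists t, q.
    by have [z []] := comeager_nonempty f.
(* The quadruple (u, n, k, q) indexes the facts that u may force. *)
pose G0 := [set x | forall i : nat * nat, exists l, D i.1 i.2 (mkseq x l)] `&`
  [set x | forall i : seq nat * nat * nat * rat, forall z, x = catx i.1.1.1 z ->
     forced i.1.1.1 (near_val i.1.1.2 i.1.2 i.2) -> near_val i.1.1.2 i.1.2 i.2 x].
have cG0 : comeager G0.
  apply: comeagerI; apply: comeager_bigcap => i; first exact: comeager_hits.
  have [f|nf] := pselect (forced i.1.1.1 (near_val i.1.1.2 i.1.2 i.2)).
    by apply: comeagerS (forced_ext f) => x h z xz _; exact: (h z).
  by exists (fun=> setT) => [n u|x _ z _ /nf//]; exists [::].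
exists [set x | forall p, G0 (paste p x)]; split.
- by apply: comeager_bigcap => p; exact: comeager_paste.
- by move=> p x Gx q; rewrite paste_paste; exact: Gx.
move=> x n e e0 /(_ [::]); rewrite paste_nil => -[hit true_forced].
have [k ke] : exists k, k.+1%:R^-1 <= e / 2 :> R.
  have := @near_infty_natSinv_lt R (PosNum (divr_gt0 e0 (@ltr0Sn R 1))).
  by case=> k _ kP; exists k; apply: ltW; apply: (kP k) => /=.
have [l [q f]] := hit (n, k); exists l => y /(_ [::]); rewrite paste_nil => -[_ +] yx.
have yE : y = catx (mkseq x l) (fun n => y (l + n)%N).
  rewrite -{1}(catx_mkseq y l); congr catx.
  by apply/eq_in_map => i; rewrite mem_iota => /yx.
move=> /(_ (mkseq x l, n, k, q) _ yE f).
have := true_forced (mkseq x l, n, k, q) _ (esym (catx_mkseq x l)) f.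
rewrite /near_val /= => h1 h2.
rewrite distrC in h1; apply: le_trans (ler_distD (ratr q) _ _) _.
apply: ltW; apply: lt_le_trans (ltrD h2 h1) _.
by apply: le_trans (lerD ke ke) _; rewrite -splitr.
Qed.

End borel_category.

(** * Fusion along a binary tree *)

Lemma extend_all (I : eqType) (Q : I -> seq nat -> Prop) (r : seq I) :
    (forall i t v, Q i t -> Q i (t ++ v)) ->
    (forall i t, i \in r -> exists v, Q i (t ++ v)) ->
  forall t, exists v, forall i, i \in r -> Q i (t ++ v).
Proof.
move=> Qcat; elim: r => [|i r IHr] Qex t; first by exists [::].
have [v Qv] := Qex i t (mem_head _ _).
have [|w Qw] := IHr _ (t ++ v).
  by move=> j u jr; apply: Qex; rewrite in_cons jr orbT.
exists (v ++ w) => j; rewrite in_cons catA => /predU1P[->|/Qw//].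
exact: Qcat.
Qed.

Lemma bound_all (I : eqType) (Q : I -> nat -> Prop) (r : seq I) :
    (forall i T T', (T <= T')%N -> Q i T -> Q i T') ->
    (forall i, i \in r -> exists T, Q i T) ->
  forall T0, exists T, (T0 <= T)%N /\ forall i, i \in r -> Q i T.
Proof.
move=> Qmono; elim: r => [|i r IHr] Qex T0; first by exists T0.
have [T QT] := Qex i (mem_head _ _).
have [|T' [T0T' QT']] := IHr _ T0.
  by move=> j jr; apply: Qex; rewrite in_cons jr orbT.
exists (maxn T T'); split=> [|j]; first by rewrite leq_max T0T' orbT.
rewrite in_cons => /predU1P[->|/QT'].
  exact: Qmono (leq_maxl _ _) QT.
exact: Qmono (leq_maxr _ _).
Qed.

Lemma catx_catl s z l z' i :
  (i < size s + l)%N -> catx (s ++ mkseq z l) z' i = catx s z i.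
Proof.
move=> il; rewrite catx_cat /catx size_mkseq; case: ltnP => // si.
by rewrite ltn_subLR // il nth_mkseq // ltn_subLR.
Qed.

(** For a map [theta] under which finite changes of the argument satisfy the tail
conditions [F k T] from some T on. The conditions [F k T] are to be closed for
pointwise convergence, and [H k T] to be a neighbourhood of 0. *)
Section fusion.
Variable R : realType.
Local Notation RN := {ptws nat -> R}.
Variables (theta : RN -> RN) (F H : nat -> nat -> set (nat -> R)).

Hypothesis borel_theta : borel_function theta.
Hypothesis F_tail : forall x y : RN, (exists N, forall n, (N <= n)%N -> x n = y n) ->
  forall k, exists T, F k T (fun n => theta x n - theta y n).
Hypothesis F_mono : forall k T T', (T <= T')%N -> F k T `<=` F k T'.
Hypothesis F_closed : forall k T d, ~ F k T d -> exists M (e : R), 0 < e /\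
  forall d', (forall n, (n < M)%N -> `|d' n - d n| <= e) -> ~ F k T d'.
Hypothesis H_nbhs : forall k T, exists M (e : R), 0 < e /\
  forall d, (forall n, (n < M)%N -> `|d n| <= e) -> H k T d.

Let diff (x y : nat -> nat) (n : nat) : R :=
  theta (letters R x) n - theta (letters R y) n.

Section stage.
Variable G : set (nat -> nat).
Hypothesis G_comeager : comeager G.
Hypothesis G_paste : forall p x, G x -> G (paste p x).
Hypothesis G_cont : forall x n (e : R), 0 < e -> G x ->
  exists l, forall y, G y -> (forall i, (i < l)%N -> y i = x i) ->
  `|theta (letters R y) n - theta (letters R x) n| <= e.

Lemma G_cont_upto x M (e : R) : 0 < e -> G x ->
  exists l, forall y, G y -> (forall i, (i < l)%N -> y i = x i) ->
  forall n, (n < M)%N -> `|theta (letters R y) n - theta (letters R x) n| <= e.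
Proof.
move=> e0 Gx.
have [||l [_ lP]] := @bound_all _ (fun n l => forall y, G y ->
    (forall i, (i < l)%N -> y i = x i) ->
    `|theta (letters R y) n - theta (letters R x) n| <= e) (iota 0 M) _ _ 0.
- move=> n l l' ll' nP y Gy yx; apply: nP => // i il; apply: yx.
  exact: leq_trans ll'.
- by move=> n _; exact: G_cont.
by exists l => y Gy yx n nM; apply: lP => //; rewrite mem_iota.
Qed.

(** For two strings of the same length, some extension decides a single T that
works for all generic continuations: otherwise the closed conditions [F k T]
would all fail at one generic continuation. *)
Lemma uniform_tail k s s' : size s = size s' -> exists v T, forall z,
  G (catx (s ++ v) z) -> F k T (diff (catx (s ++ v) z) (catx (s' ++ v) z)).
Proof.
move=> ss'; apply: contrapT => no.
have Gswap v z : G (catx (s ++ v) z) -> G (catx (s' ++ v) z).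
  move=> /(G_paste (s' ++ v)); rewrite paste_catx // !size_cat ss' //.
pose E T : set (seq nat) := [set w | forall z, G (catx (s ++ w) z) ->
   ~ F k T (diff (catx (s ++ w) z) (catx (s' ++ w) z))].
have coE T : cofinal (E T).
  move=> u; have [z [Gz nF]] : exists z, G (catx (s ++ u) z) /\
     ~ F k T (diff (catx (s ++ u) z) (catx (s' ++ u) z)).
    apply: contrapT => nz; apply: no; exists u, T => z Gz.
    by apply: contrapT => nF; apply: nz; exists z.
  have [M [e [e0 far]]] := F_closed nF.
  have e20 : 0 < e / 2 by rewrite divr_gt0.
  have [l lP] := G_cont_upto M e20 Gz.
  have [l' lP'] := G_cont_upto M e20 (Gswap _ _ Gz).
  exists (mkseq z (maxn l l')) => z' Gz'; apply: far => n nM.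
  have h := lP _ Gz' _ _ nM; have h' := lP' _ (Gswap _ _ Gz') _ _ nM.
  rewrite /diff opprB addrACA [X in X + _]addrC -addrA.
  rewrite [X in `|X|](_ : _ =
     (theta (letters R (catx (s ++ u ++ mkseq z (maxn l l')) z')) n
        - theta (letters R (catx (s ++ u) z)) n)
     - (theta (letters R (catx (s' ++ u ++ mkseq z (maxn l l')) z')) n
        - theta (letters R (catx (s' ++ u) z)) n)); last by ring.
  apply: le_trans (ler_normB _ _) _; rewrite [leRHS]splitr lerD //.
    by apply: h => i il; rewrite catA catx_catl //; lia.
  by apply: h' => i il; rewrite catA catx_catl //; lia.
have /comeager_nonempty[z [Gz Ez]] :
    comeager ([set z | G (catx s z)] `&`
              [set z | forall T, exists l, E T (mkseq z l)]).
  apply: comeagerI; first exact: comeager_forced.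
  by apply: comeager_bigcap => T; exact: comeager_hits.
have [|T FT] := @F_tail (letters R (catx s z)) (letters R (catx s' z)) _ k.
  exists (size s) => n sn; rewrite /letters /catx -ss' ltnNge sn //.
have [l] := Ez T; move=> /(_ (fun n => z (l + n)%N)).
by rewrite !catx_cat !catx_mkseq; apply.
Qed.

(** Continuity at one generic continuation. *)
Lemma uniform_head k T s : exists v, forall z z',
  G (catx (s ++ v) z) -> G (catx (s ++ v) z') ->
  H k T (diff (catx (s ++ v) z) (catx (s ++ v) z')).
Proof.
have [M [e [e0 near0]]] := H_nbhs k T.
have e20 : 0 < e / 2 by rewrite divr_gt0.
have [z0 Gz0] := comeager_nonempty (comeager_forced s G_comeager).
have [l lP] := G_cont_upto M e20 Gz0.
exists (mkseq z0 l) => z z' Gz Gz'; apply: near0 => n nM.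
have agree w i : (i < l)%N -> catx (s ++ mkseq z0 l) w i = catx s z0 i.
  by move=> il; apply: catx_catl; lia.
have h := lP _ Gz (agree z) n nM; have h' := lP _ Gz' (agree z') n nM.
rewrite distrC in h'; rewrite /diff.
apply: le_trans (ler_distD (theta (letters R (catx s z0)) n) _ _) _.
by rewrite [leRHS]splitr lerD.
Qed.

(** One step serves the finitely many strings of a level of the tree at once. The
string t is extended three times: into the k-th cofinal set, which makes all the
branches generic in the end; then for the tail conditions, which fix T; and then
for the head conditions, which depend on T. *)
Lemma fusion_stage (D : nat -> set (seq nat)) k T0 (S : seq (seq nat)) :
    (forall n, cofinal (D n)) ->
    (forall s s', s \in S -> s' \in S -> size s = size s') ->
  exists t T, [/\ (T0 < T)%N,
    forall s, s \in S -> exists2 l, (l <= size (s ++ t))%N & D k (take l (s ++ t)),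
    forall s s', s \in S -> s' \in S -> forall z, G (catx (s ++ t) z) ->
      F k T (diff (catx (s ++ t) z) (catx (s' ++ t) z)) &
    forall s, s \in S -> forall z z', G (catx (s ++ t) z) -> G (catx (s ++ t) z') ->
      H k T (diff (catx (s ++ t) z) (catx (s ++ t) z'))].
Proof.
move=> coD sizeS.
have [|s t sS|t1 D1] := @extend_all _ (fun s t =>
    exists2 l, (l <= size (s ++ t))%N & D k (take l (s ++ t))) S _ _ [::].
- move=> s t v [l lst Dl]; exists l.
    by rewrite catA size_cat (leq_trans lst) ?leq_addr.
  by rewrite catA takel_cat.
- have [v Dv] := coD k (s ++ t); exists v, (size (s ++ t ++ v)) => //.
  by rewrite take_size catA.
pose pairs := [seq (s, s') | s <- S, s' <- S].
have pairsP s s' : (s, s') \in pairs <-> s \in S /\ s' \in S.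
  by split=> [/allpairsP[[a b] /= [aS bS [-> ->]]]|[sS s'S]]//; exact: allpairs_f.
have [||t2 F2] := @extend_all _ (fun p t => exists T, forall z,
    G (catx (p.1 ++ t) z) ->
    F k T (diff (catx (p.1 ++ t) z) (catx (p.2 ++ t) z))) pairs _ _ t1.
- move=> p t v [T FT]; exists T => z; rewrite !catA.
  by rewrite 2!(catx_cat (_ ++ t)); exact: FT.
- move=> [s s'] t /pairsP[sS s'S] /=.
  have [|v [T FT]] := @uniform_tail k (s ++ t) (s' ++ t).
    by rewrite !size_cat (sizeS s s').
  by exists v, T; rewrite !catA.
have [||T [T0T FT]] := @bound_all _ (fun p T => forall z,
    G (catx (p.1 ++ t1 ++ t2) z) ->
    F k T (diff (catx (p.1 ++ t1 ++ t2) z) (catx (p.2 ++ t1 ++ t2) z)))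
    pairs _ _ T0.+1.
- by move=> p T T' TT' FT z Gz; apply: F_mono TT' _ _; exact: FT.
- by move=> p /F2.
have [||t3 H3] := @extend_all _ (fun s t => forall z z',
    G (catx (s ++ t) z) -> G (catx (s ++ t) z') ->
    H k T (diff (catx (s ++ t) z) (catx (s ++ t) z'))) S _ _ (t1 ++ t2).
- move=> s t v Hst z z'; rewrite catA 2!(catx_cat (s ++ t)); exact: Hst.
- move=> s t _; have [v Hv] := @uniform_head k T (s ++ t).
  by exists v => z z'; rewrite catA; exact: Hv.
exists ((t1 ++ t2) ++ t3), T; split=> //.
- move=> s /D1 /= [l lst Dl]; exists l.
    by rewrite -catA catA size_cat (leq_trans lst) ?leq_addr.
  by rewrite -catA catA takel_cat.
- move=> s s' sS s'S z; rewrite 2!(catA _ _ t3) 2!(catx_cat (_ ++ t1 ++ t2)).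
  exact: (FT (s, s') ((pairsP s s').2 (conj sS s'S))).
Qed.

End stage.

(** The k-th bit chooses the letter 0 or [c k] at [pos k]; the letters between
these positions come from [fusion_stage] and are common to all branches. Branches
with the same bits from k on are the same sequence after two strings of level k,
which gives the conditions F; branches with the same bits below k share a string
of level k, which gives the conditions H. *)
Theorem fusion (c : nat -> nat) :
  exists (x : (nat -> bool) -> RN) (pos T : nat -> nat),
  [/\ {homo pos : i j / (i < j)%N}, {homo T : i j / (i < j)%N},
      forall a k, x a (pos k) = if a k then (c k)%:R^-1 else 0,
      forall a b n, (forall k, n <> pos k) -> x a n = x b n &
      (forall k a b, (forall i, (k <= i)%N -> a i = b i) ->
         F k (T k) (fun n => theta (x a) n - theta (x b) n)) /\
      (forall k a b, (forall i, (i < k)%N -> a i = b i) ->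
         H k (T k) (fun n => theta (x a) n - theta (x b) n))].
Proof.
have [G [G_comeager G_paste G_cont]] := borel_generic_continuity borel_theta.
have [D coD DG] := G_comeager.
have /choice[e eP] : forall kTS : nat * nat * seq (seq nat), exists tT : seq nat * nat,
    (forall s s', s \in kTS.2 -> s' \in kTS.2 -> size s = size s') ->
    [/\ (kTS.1.2 < tT.2)%N,
    forall s, s \in kTS.2 -> exists2 l, (l <= size (s ++ tT.1))%N &
      D kTS.1.1 (take l (s ++ tT.1)),
    forall s s', s \in kTS.2 -> s' \in kTS.2 -> forall z, G (catx (s ++ tT.1) z) ->
      F kTS.1.1 tT.2 (diff (catx (s ++ tT.1) z) (catx (s' ++ tT.1) z)) &
    forall s, s \in kTS.2 -> forall z z',
      G (catx (s ++ tT.1) z) -> G (catx (s ++ tT.1) z') ->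
      H kTS.1.1 tT.2 (diff (catx (s ++ tT.1) z) (catx (s ++ tT.1) z'))].
  move=> [[k T0] S] /=.
  have [sizeS|nsizeS] := pselect
      (forall s s', s \in S -> s' \in S -> size s = size s').
    have [t [T tT]] := fusion_stage G_comeager G_paste G_cont k T0 coD sizeS.
    by exists (t, T).
  by exists ([::], 0%N).
(* The strings of level k, and the index T of the previous level. *)
pose st := fix st k : seq (seq nat) * nat := if k is j.+1 then
   let tT := e (j, (st j).2, (st j).1) in
   ([seq rcons (s ++ tT.1) b | s <- (st j).1, b <- [:: 0%N; c j]], tT.2)
   else ([:: [::]], 0%N).
pose t k := (e (k, (st k).2, (st k).1)).1.
pose T k := (e (k, (st k).2, (st k).1)).2.
(* The string of level k on the branch a; its length is [len k]. *)
pose S (a : nat -> bool) := fix S k := if k is j.+1 then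
   rcons (S j ++ t j) (if a j then c j else 0%N) else [::].
pose len := fix len k := if k is j.+1 then (len j + size (t j)).+1 else 0%N.
pose pos k := (len k + size (t k))%N.
have stS k : (st k.+1).1 =
    [seq rcons (s ++ t k) b | s <- (st k).1, b <- [:: 0%N; c k]] by [].
have size_st k s : s \in (st k).1 -> size s = len k.
  elim: k s => [|k IHk] s; first by rewrite inE => /eqP->.
  rewrite stS => /allpairsP[[s' b] [/= /IHk s'k _ ->]].
  by rewrite size_rcons size_cat s'k.
have S_st a k : S a k \in (st k).1.
  elim: k => [|k IHk]; first by rewrite inE.
  by rewrite stS; apply: allpairs_f => //; rewrite !inE; case: (a k); rewrite eqxx ?orbT.
have size_S a k : size (S a k) = len k by apply: size_st.
have stP k := eP (k, (st k).2, (st k).1)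
  (fun s s' hs hs' => etrans (size_st k s hs) (esym (size_st k s' hs'))).
have S_pre a k : prefix (S a k) (S a k.+1).
  by rewrite /= -cats1 -catA; exact: prefix_prefix.
have len_ge k : (k <= len k)%N.
  by elim: k => //= k IHk; rewrite ltnS (leq_trans IHk) ?leq_addr.
pose x a n := nth 0%N (S a n.+1) n.
have x_len a k : mkseq (x a) (len k) = S a k.
  rewrite -(size_S a k); apply: string_limit; first exact: S_pre.
  by move=> j; rewrite size_S.
have x_pos a k : mkseq (x a) (pos k) = S a k ++ t k.
  have := congr1 (take (pos k)) (x_len a k.+1).
  rewrite /= -/(pos k) -cats1 take_size_cat; last by rewrite size_cat size_S.
  by rewrite /mkseq -map_take take_iota (minn_idPl (leqnSn _)).
have x_letter a k : x a (pos k) = if a k then c k else 0%N.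
  have := congr1 (fun s => nth 0%N s (pos k)) (x_len a k.+1).
  rewrite nth_mkseq ?ltnSn // => ->.
  by rewrite /= nth_rcons size_cat size_S ltnn eqxx.
have x_else a b n : (forall k, n <> pos k) -> x a n = x b n.
  move=> npos; rewrite /x; elim: n.+1 => //= k IHk.
  rewrite !nth_rcons !size_cat !size_S !nth_cat !size_S.
  have /eqP/negbTE-> := npos k.
  by rewrite IHk.
have pos_incr k : (pos k < pos k.+1)%N by rewrite /pos /= addSn ltnS leq_addr.
have pos_homo : {homo pos : i j / (i < j)%N}.
  by apply: homo_ltn; [exact: ltn_trans|exact: pos_incr].
have xG a : G (x a).
  apply: DG => k; have [_ /(_ _ (S_st a k))[l lst Dl] _ _] := stP k.
  exists l; move: Dl; rewrite /= -/(t k) -x_pos.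
  rewrite /= -/(t k) -x_pos size_mkseq in lst.
  by rewrite /mkseq -map_take take_iota (minn_idPl lst).
have x_split a k : x a = catx (S a k ++ t k) (fun n => x a (pos k + n)%N).
  by rewrite -x_pos catx_mkseq.
exists (fun a => letters R (x a)), pos, T; split.
- exact: pos_homo.
- apply: homo_ltn; first exact: ltn_trans.
  by move=> k; have [h _ _ _] := stP k.+1; exact: h.
- by move=> a k; rewrite /letters x_letter; case: (a k); rewrite // invr0.
- by move=> a b n npos; rewrite /letters (x_else a b).
split=> k a b ab.
- have [_ _ /(_ _ _ (S_st a k) (S_st b k)) FT _] := stP k.
  have tails : (fun n => x a (pos k + n)%N) = (fun n => x b (pos k + n)%N).
    apply/funext => n; have [[i ni]|no] := pselect (exists i, (pos k + n)%N = pos i).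
      rewrite ni !x_letter ab // leqNgt; apply/negP => /pos_homo.
      by rewrite -ni ltnNge leq_addr.
    by apply: x_else => i ni; apply: no; exists i.
  have := FT (fun n => x a (pos k + n)%N); rewrite /= -/(t k) -x_split tails -x_split.
  by apply; exact: xG.
- have Sab : S a k = S b k.
    elim: k ab => //= k IHk ab; rewrite IHk; first by rewrite ab.
    by move=> i ik; apply: ab; rewrite ltnS ltnW.
  have [_ _ _ /(_ _ (S_st a k)) HT] := stP k.
  have := HT (fun n => x a (pos k + n)%N) (fun n => x b (pos k + n)%N).
  by rewrite /= -/(t k) -x_split Sab -x_split; apply; exact: xG.
Qed.

End fusion.

(** * Isolating one bit *)

Definition single k (a : nat -> bool) i := (i == k) && a i.

Definition upto k (a : nat -> bool) i := (i <= k)%N && a i.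

Lemma upto_agree k (a : nat -> bool) i : (i < k.+1)%N -> a i = upto k a i.
Proof. by rewrite /upto ltnS => ->. Qed.

Lemma upto_single k (a : nat -> bool) i : (k <= i)%N -> upto k a i = single k a i.
Proof. by rewrite /upto /single eqn_leq => ->; rewrite andbT. Qed.

Lemma singleE k (a : nat -> bool) :
  single k a = if a k then (fun i => i == k) else (fun=> false).
Proof.
apply/funext => i; rewrite /single.
by have [->|/negbTE ik] := eqVneq i k; case: (a k); rewrite //= ?eqxx ?ik.
Qed.

(** * Borel reductions *)

Lemma continuous_borel (Z W : topologicalType) (f : Z -> W) :
  continuous f -> borel_function f.
Proof.
move=> /continuousP cf B sB.
apply: (sB [set B | <<s @open Z >> (f @^-1` B)]); split; first split.
- by rewrite /= preimage_set0; exact: sigma_algebra0.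
- move=> A sA; rewrite /= setTD preimage_setC -setTD; exact: sigma_algebraCD.
- by move=> A sA; rewrite /= preimage_bigcup; exact: sigma_algebra_bigcup.
- by move=> U oU; apply: sub_sigma_algebra; exact: cf.
Qed.

Lemma borel_reducible_trans (X Y Z : topologicalType)
    (E : X -> X -> Prop) (F : Y -> Y -> Prop) (G : Z -> Z -> Prop) :
  borel_reducible E F -> borel_reducible F G -> borel_reducible E G.
Proof.
move=> [f bf fEF] [g bg gFG]; exists (g \o f) => [B sB|x y].
  by rewrite comp_preimage; apply: bf; exact: bg.
by rewrite fEF gFG.
Qed.

Lemma continuous_ptws (Z : topologicalType) (R : realType) (f : Z -> {ptws nat -> R}) :
  (forall n, continuous (fun z => f z n)) -> continuous f.
Proof.
move=> cf z; have : {ptws, f @ nbhs z --> f z}; last exact.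
by apply/pointwise_cvgP => n; exact: cf.
Qed.

Lemma continuous_coordinate (R : realType) n :
  continuous (fun a : {ptws nat -> R} => a n).
Proof. exact: (@proj_continuous _ (fun=> R) n). Qed.

(** * Sums and limits of real sequences *)

Section real_sequences.
Variable R : realType.
Implicit Types (u : nat -> R) (e : R).

Lemma nneseries_boundedP u : (forall n, 0 <= u n) ->
  (\sum_(n <oo) (u n)%:E < +oo)%E <-> exists M, forall n, \sum_(0 <= i < n) u i <= M.
Proof.
move=> u0; split=> [fin|[M uM]].
  have s0 : (0 <= \sum_(n <oo) (u n)%:E)%E.
    by apply: nneseries_ge0 => n _ _; rewrite lee_fin.
  exists (fine (\sum_(n <oo) (u n)%:E)%E) => n.
  rewrite -lee_fin fineK; last by rewrite ge0_fin_numE.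
  rewrite -sumEFin; apply: nneseries_lim_ge => k _ _; by rewrite lee_fin.
apply: (@le_lt_trans _ _ M%:E); last exact: ltry.
apply: lime_le; first by apply: is_cvg_nneseries => k _ _; rewrite lee_fin.
by apply: nearW => n; rewrite sumEFin lee_fin.
Qed.

Lemma c0P (a : {ptws nat -> R}) :
  c0 a <-> forall e, 0 < e -> exists N, forall n, (N <= n)%N -> `|a n| <= e.
Proof.
split=> [/cvgr0Pnorm_le ca e e0|ca].
  by have [N _ Na] := ca e e0; exists N => n Nn; exact: Na.
apply/cvgr0Pnorm_le => e e0; have [N Na] := ca e e0.
by exists N => // n /= Nn; exact: Na.
Qed.

Lemma cvgn_cauchyP u : cvgn u <->
  forall e, 0 < e -> exists N, forall n, (N <= n)%N -> `|u n - u N| <= e.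
Proof.
split=> [/cvg_ex[l /cvgrPdist_le ul] e e0|cu].
  have e20 : 0 < e / 2 by rewrite divr_gt0.
  have [N _ uN] := ul _ e20.
  exists N => n Nn; apply: le_trans (ler_distD l _ _) _.
  rewrite [leRHS]splitr lerD //; last by apply: uN => /=.
  by rewrite distrC; exact: uN.
apply: cauchy_cvg; apply: cauchy_exP => e e0.
have e20 : 0 < e / 2 by rewrite divr_gt0.
have [N uN] := cu _ e20.
exists (u N), N => // n /= Nn; rewrite -ball_normE /= distrC.
by apply: le_lt_trans (uN _ Nn) _; rewrite ltr_pdivrMr // ltr_pMr // ltr1n.
Qed.

Lemma bounded_tail u : (forall n, 0 <= u n) ->
    (exists M, forall n, \sum_(0 <= i < n) u i <= M) ->
  forall e, 0 < e -> exists N, forall k n, (N <= k)%N -> \sum_(k <= i < n) u i <= e.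
Proof.
move=> u0 [M uM] e e0.
have mono : nondecreasing_seq (series u).
  move=> i j ij; rewrite /series /= (@big_cat_nat _ _ _ i 0 j) //= lerDl.
  by apply: sumr_ge0.
have /cvgn_cauchyP/(_ e e0)[N uN] : cvgn (series u).
  by apply: nondecreasing_is_cvgn => //; exists M => _ [n _ <-]; exact: uM.
exists N => k n Nk; have [kn|nk] := leqP k n; last by rewrite big_geq ?ltW // ltnW.
have := uN n (leq_trans Nk kn); rewrite /series /=.
rewrite (@big_cat_nat _ _ _ N 0 n) //=; last exact: leq_trans kn.
rewrite (@big_cat_nat _ _ _ k N n) //= addrAC subrr add0r.
move=> h; apply: le_trans h; apply: le_trans (ler_norm _).
by rewrite lerDr; apply: sumr_ge0.
Qed.

Lemma sum_nat_le u m n m' n' : (forall n, 0 <= u n) -> (m' <= m)%N -> (n <= n')%N ->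
  \sum_(m <= i < n) u i <= \sum_(m' <= i < n') u i.
Proof.
move=> u0 mm nn; have [mn|nm] := leqP m n; last first.
  by rewrite big_geq ?(ltnW nm) //; apply: sumr_ge0.
rewrite (@big_cat_nat _ _ _ m m' n') //=; last by apply: leq_trans nn.
rewrite (@big_cat_nat _ _ _ n m n') //= addrCA lerDl addr_ge0 //; exact: sumr_ge0.
Qed.

Lemma homo_ltn_id (p : nat -> nat) : {homo p : i j / (i < j)%N} ->
  forall n, (n <= p n)%N.
Proof.
by move=> p_incr; elim=> // n IHn; apply: leq_ltn_trans IHn (p_incr _ _ (ltnSn n)).
Qed.

Lemma homo_ltn_leq (p : nat -> nat) : {homo p : i j / (i < j)%N} ->
  {homo p : i j / (i <= j)%N}.
Proof.
by move=> p_incr i j; rewrite leq_eqVlt => /predU1P[->//|/p_incr/ltnW].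
Qed.

Lemma sum_blocks u (T : nat -> nat) a b : {homo T : i j / (i < j)%N} -> (a <= b)%N ->
  \sum_(T a <= n < T b) u n = \sum_(a <= k < b) \sum_(T k <= n < T k.+1) u n.
Proof.
move=> T_incr; elim: b => [|b IHb]; first by rewrite leqn0 => /eqP->; rewrite !big_geq.
rewrite leq_eqVlt => /predU1P[->|]; first by rewrite !big_geq.
rewrite ltnS => ab; rewrite big_nat_recr //= -IHb // (@big_cat_nat _ _ _ (T b)) //=.
  exact: homo_ltn_leq.
exact/ltnW/T_incr.
Qed.

Lemma sum_subseq_le u (p : nat -> nat) M : (forall n, 0 <= u n) ->
  {homo p : i j / (i < j)%N} ->
  \sum_(0 <= k < M) u (p k) <= \sum_(0 <= n < p M) u n.
Proof.
move=> u0 p_incr; apply: le_trans (sum_nat_le u0 (leq0n (p 0%N)) (leqnn _)).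
rewrite sum_blocks //; apply: ler_sum => k _.
by rewrite big_ltn ?p_incr // lerDl; apply: sumr_ge0.
Qed.

Lemma sum_subseq_ge u (p : nat -> nat) M : (forall n, 0 <= u n) ->
  {homo p : i j / (i < j)%N} -> (forall n, (forall k, n <> p k) -> u n = 0) ->
  \sum_(0 <= n < M) u n <= \sum_(0 <= k < M) u (p k).
Proof.
move=> u0 p_incr u_p; apply: le_trans (sum_nat_le u0 (leqnn 0%N) (homo_ltn_id p_incr M)) _.
have gap a b : (forall n, (a <= n < b)%N -> forall k, n <> p k) ->
    \sum_(a <= n < b) u n = 0.
  by move=> ab; rewrite big_nat_cond big1 // => n /andP[/ab/u_p].
rewrite (@big_cat_nat _ _ _ (p 0%N)) //=; last exact: homo_ltn_leq.
rewrite gap ?add0r => [|n np k nk]; last first.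
  by have := homo_ltn_leq p_incr (leq0n k); rewrite -nk leqNgt; case/andP: np => _ ->.
rewrite sum_blocks //; apply: ler_sum => k _.
rewrite big_ltn ?p_incr // gap ?addr0 // => n /andP[kn nk] i ni.
have [ik|ki] := leqP i k; first by have := homo_ltn_leq p_incr ik; rewrite -ni leqNgt kn.
by have := homo_ltn_leq p_incr ki; rewrite -ni leqNgt nk.
Qed.

Definition pow_half k : R := 2^-1 ^+ k.

Lemma pow_half_gt0 k : 0 < pow_half k. Proof. by rewrite exprn_gt0 // invr_gt0. Qed.

Lemma pow_halfS k : pow_half k = pow_half k.+1 + pow_half k.+1.
Proof.
rewrite /pow_half exprS -mulrDl -[LHS]mul1r; congr (_ * _).
by rewrite [LHS]splitr mul1r.
Qed.

Lemma pow_half_le i j : (i <= j)%N -> pow_half j <= pow_half i.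
Proof. by move=> ij; rewrite /pow_half ler_wiXn2l // ?invr_ge0 // invf_le1 // ler1n. Qed.

Lemma pow_half_small e : 0 < e -> exists k, pow_half k <= e.
Proof.
move=> e0; have [k _ ke] := @near_infty_natSinv_lt R (PosNum e0).
exists k; apply: le_trans (ltW (ke k (leqnn k))).
rewrite /pow_half exprVn lef_pV2 ?posrE ?exprn_gt0 // -natrX ler_nat.
exact: ltn_expl.
Qed.

Lemma pow_half_sum a b : (a <= b)%N ->
  \sum_(a <= k < b) pow_half k = 2 * pow_half a - 2 * pow_half b.
Proof.
move=> ab; elim: b ab => [|b IHb].
  by rewrite leqn0 => /eqP->; rewrite big_geq // subrr.
rewrite leq_eqVlt => /predU1P[->|]; first by rewrite big_geq // subrr.
by rewrite ltnS => ab; rewrite big_nat_recr //= IHb // (pow_halfS b); lra.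
Qed.

Lemma pow_half_sum_le a b : \sum_(a <= k < b) pow_half k <= 2 * pow_half a.
Proof.
have [ab|/ltnW ba] := leqP a b.
  by rewrite pow_half_sum // gerBl mulr_ge0 // ltW // pow_half_gt0.
by rewrite big_geq // mulr_ge0 // ltW // pow_half_gt0.
Qed.

(** Upper bounds on such functionals are closed for pointwise convergence, and are
neighbourhoods of 0 when the functional vanishes there: the two kinds of
conditions that [fusion] asks for. *)
Definition finitely_lipschitz (f : (nat -> R) -> R) := exists N C, 0 <= C /\
  forall d d' e, (forall n, (n < N)%N -> `|d' n - d n| <= e) -> `|f d' - f d| <= C * e.

Lemma finitely_lipschitz_coordinate n : finitely_lipschitz (fun d => d n).
Proof. by exists n.+1, 1; split=> // d d' e; rewrite mul1r; apply. Qed.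

Lemma finitely_lipschitzD f g : finitely_lipschitz f -> finitely_lipschitz g ->
  finitely_lipschitz (fun d => f d + g d).
Proof.
move=> [N [C [C0 fC]]] [N' [C' [C'0 gC']]]; exists (maxn N N'), (C + C').
split=> [|d d' e dd']; first exact: addr_ge0.
rewrite opprD addrACA mulrDl; apply: le_trans (ler_normD _ _) (lerD _ _).
  by apply: fC => n nN; apply: dd'; rewrite leq_max nN.
by apply: gC' => n nN; apply: dd'; rewrite leq_max nN orbT.
Qed.

Lemma finitely_lipschitzN f : finitely_lipschitz f -> finitely_lipschitz (fun d => - f d).
Proof.
move=> [N [C [C0 fC]]]; exists N, C; split=> // d d' e dd'.
by rewrite -opprD normrN; exact: fC.
Qed.

Lemma finitely_lipschitz_norm f : finitely_lipschitz f ->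
  finitely_lipschitz (fun d => `|f d|).
Proof.
move=> [N [C [C0 fC]]]; exists N, C; split=> // d d' e dd'.
by apply: le_trans (ler_dist_dist _ _) _; exact: fC.
Qed.

Lemma finitely_lipschitz_sum (f : nat -> (nat -> R) -> R) a b :
  (forall i, finitely_lipschitz (f i)) ->
  finitely_lipschitz (fun d => \sum_(a <= i < b) f i d).
Proof.
move=> fL; rewrite /index_iota; elim: (iota _ _) => [|i r IHr].
  by exists 0%N, 0; split=> // d d' e _; rewrite !big_nil subr0 normr0 mul0r.
have := finitely_lipschitzD (fL i) IHr.
by congr finitely_lipschitz; apply/funext => d; rewrite big_cons.
Qed.

Lemma finitely_lipschitz_gt f r d : finitely_lipschitz f -> r < f d ->
  exists N e, 0 < e /\
    forall d', (forall n, (n < N)%N -> `|d' n - d n| <= e) -> r < f d'.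
Proof.
move=> [N [C [C0 fC]]] rf; exists N, ((f d - r) / (C + 1)).
have C1 : 0 < C + 1 by rewrite ltr_wpDl.
split=> [|d' dd']; first by rewrite divr_gt0 // subr_gt0.
have fr : 0 < f d - r by rewrite subr_gt0.
have lt : C * ((f d - r) / (C + 1)) < f d - r.
  by rewrite mulrA ltr_pdivrMr // mulrC mulrDr mulr1 ltrDl.
have := le_lt_trans (fC _ _ _ dd') lt; rewrite ltr_norml => /andP[h _].
by rewrite -(ltrD2r (- f d)); apply: le_lt_trans h; rewrite opprB.
Qed.

Lemma finitely_lipschitz_near0 f r : finitely_lipschitz f -> f (fun=> 0) = 0 -> 0 < r ->
  exists N e, 0 < e /\ forall d, (forall n, (n < N)%N -> `|d n| <= e) -> f d <= r.
Proof.
move=> fL f0 r0.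
have [||N [e [e0 fN]]] := @finitely_lipschitz_gt (fun d => - f d) (- r) (fun=> 0).
- exact: finitely_lipschitzN.
- by rewrite f0 oppr0 oppr_lt0.
exists N, e; split=> // d dN; rewrite -lerN2 ltW //; apply: fN => n /dN.
by rewrite subr0.
Qed.

End real_sequences.

(** * Sequences of bounded variation along rows *)

Section bounded_variation.
Variables (R : realType) (pr : nat * nat -> nat) (g : nat -> nat * nat).
Local Notation RN := {ptws nat -> R}.
Hypothesis prK : cancel pr g.
Hypothesis gK : cancel g pr.
Hypothesis pr_incr : forall i, {homo (fun j => pr (i, j)) : j k / (j < k)%N}.

Definition row_succ n := pr ((g n).1, (g n).2.+1).

Definition jump (d : nat -> R) n := d n - d (row_succ n).

Lemma row_succ_pr i j : row_succ (pr (i, j)) = pr (i, j.+1).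
Proof. by rewrite /row_succ prK. Qed.

(** Every index is in exactly one place of one row, so the iterated sum over the
rows is a sum over all indices. *)
Lemma bv_inftyP (d : RN) :
  bv_infty pr d <-> exists M, forall n, \sum_(0 <= i < n) `|jump d i| <= M.
Proof.
rewrite -nneseries_boundedP //.
suff -> : (\sum_(n <oo) `|jump d n|%:E = \sum_(i <oo) \sum_(j <oo)
              `|d (pr (i, j)) - d (pr (i, j.+1))|%:E)%E by [].
rewrite nneseries_esumT; last by move=> n; rewrite lee_fin.
rewrite (reindex_esum (setT `*`` (fun=> setT)) setT
  (fun k => pr (k.1, k.2))) /=; last first.
  split=> //; first by move=> [i j] [i' j'] _ _ /(can_inj prK).
  by move=> n _; exists (g n); rewrite -?surjective_pairing.
rewrite -(@esum_esum _ _ _ setT (fun=> setT)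
  (fun i j => `|jump d (pr (i, j))|%:E)) //.
rewrite [RHS]nneseries_esumT; last first.
  by move=> i; apply: nneseries_ge0 => j _ _; rewrite lee_fin.
apply: eq_esum => i _; rewrite [RHS]nneseries_esumT; last by move=> j; rewrite lee_fin.
by apply: eq_esum => j _; rewrite /jump row_succ_pr.
Qed.

(** Indices increase along a row, so the jumps of the row between two places are
among those of all the indices between them. *)
Lemma row_variation (d : nat -> R) i j0 j : (j0 <= j)%N ->
  `|d (pr (i, j0)) - d (pr (i, j))| <=
  \sum_(pr (i, j0) <= n < pr (i, j)) `|jump d n|.
Proof.
move=> j0j; rewrite (sum_blocks _ (pr_incr i) j0j).
apply: (@le_trans _ _ (\sum_(j0 <= k < j) `|jump d (pr (i, k))|)).
  elim: j j0j => [|j IHj]; first by rewrite leqn0 => /eqP->; rewrite subrr normr0 big_geq.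
  rewrite leq_eqVlt => /predU1P[->|]; first by rewrite subrr normr0 big_geq.
  rewrite ltnS => j0j; rewrite big_nat_recr //=.
  apply: le_trans (ler_distD (d (pr (i, j))) _ _) _; rewrite lerD ?IHj //.
  by rewrite /jump row_succ_pr.
apply: ler_sum => k _; rewrite big_ltn; last exact: pr_incr.
by rewrite lerDl; apply: sumr_ge0.
Qed.

(** A tail of the variation bounds the oscillation of every row beyond the
corresponding index, so null rows of bounded variation are uniformly null. *)
Lemma bv_rows_c0 (d : RN) : bv_infty pr d ->
    (forall i e, 0 < e -> exists N, forall j, (N <= j)%N -> `|d (pr (i, j))| <= e) ->
  c0 d.
Proof.
move=> /bv_inftyP bd rows; apply/c0P => e e0.
have e20 : 0 < e / 2 by rewrite divr_gt0.
have [N tail] := bounded_tail (fun n => normr_ge0 (jump d n)) bd e20.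
exists N => n Nn; rewrite -(gK n); case: (g n) (gK n) => i j nE.
have [J rowJ] := rows i _ e20.
have := rowJ _ (leq_maxl J j).
have := row_variation d i (leq_maxr J j); rewrite nE => h1 h2.
have h3 := tail n (pr (i, maxn J j)) Nn.
have := ler_normD (d n - d (pr (i, maxn J j))) (d (pr (i, maxn J j))).
by rewrite subrK => h4; lra.
Qed.

(** A sequence of bounded variation is one whose jumps are summable, and taking
jumps is linear and continuous. *)
Lemma bv0_reducible :
  borel_reducible (coset_rel (@bv0_infty R pr))
                  (prod_rel (coset_rel (@l1 R)) (coset_rel (@c0 R))).
Proof.
have jump_continuous : continuous (fun a : RN => (jump a : RN)).
  apply: continuous_ptws => n z.
  exact: (@cvgB R R^o _ (nbhs z) _ (fun a : RN => a n) (fun a => a (row_succ n)) _ _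
    (@continuous_coordinate R n z) (@continuous_coordinate R _ z)).
exists (fun a : RN => (jump a : RN, a)) => [|a b].
  apply: continuous_borel => a; exact: (cvg_pair (jump_continuous a) cvg_id).
rewrite /coset_rel /prod_rel /bv0_infty /=.
have -> : l1 (fun n => jump a n - jump b n) <-> bv_infty pr (fun n => a n - b n).
  rewrite bv_inftyP -nneseries_boundedP //.
  suff -> : (fun n => jump a n - jump b n) = jump (fun n => a n - b n) by [].
  by apply/funext => n; rewrite /jump; ring.
by [].
Qed.

End bounded_variation.

Lemma c0_reducible_prod (R : realType) :
  borel_reducible (coset_rel (@c0 R))
                  (prod_rel (coset_rel (@l1 R)) (coset_rel (@c0 R))).
Proof.
exists (fun a : {ptws nat -> R} => ((fun=> 0) : {ptws nat -> R}, a)) => [|a b].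
  have cst_continuous :
      continuous (fun _ : {ptws nat -> R} => (fun=> 0) : {ptws nat -> R}).
    exact: (@cst_continuous {ptws nat -> R} {ptws nat -> R} (fun=> 0)).
  apply: continuous_borel => a; exact: (cvg_pair (cst_continuous a) cvg_id).
rewrite /prod_rel /coset_rel /=; split=> [ab|[]//]; split=> //.
rewrite /l1 /=; apply/nneseries_boundedP => //.
by exists 0 => n; rewrite big1 // => i _; rewrite subrr normr0.
Qed.

(** * Null sequences do not reduce to null sequences of bounded variation *)

Section no_reduction_to_bv0.
Variables (R : realType) (pr : nat * nat -> nat) (g : nat -> nat * nat).
Local Notation RN := {ptws nat -> R}.
Hypothesis prK : cancel pr g.
Hypothesis gK : cancel g pr.
Hypothesis pr_incr : forall i, {homo (fun j => pr (i, j)) : j k / (j < k)%N}.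
Variable theta : RN -> RN.
Hypothesis borel_theta : borel_function theta.

Hypothesis theta_red : forall x y : RN,
  coset_rel (@c0 R) x y <-> coset_rel (@bv0_infty R pr) (theta x) (theta y).

Let jmp (d : nat -> R) := jump pr g d.
(* The positions [pr (i, j)] carry the letter i, so every letter occurs infinitely
   often. *)
Let letter n := (g n).1.

Let var_tail k T : set (nat -> R) :=
  [set d | forall M, \sum_(T <= n < M) `|jmp d n| <= pow_half R k].
Let var_head k T : set (nat -> R) :=
  [set d | \sum_(0 <= n < T) `|jmp d n| + \sum_(0 <= n < k) `|d n| <= pow_half R k].

Lemma finitely_lipschitz_jump n : finitely_lipschitz (fun d => `|jmp d n|).
Proof.
apply: finitely_lipschitz_norm; apply: finitely_lipschitzD.
  exact: finitely_lipschitz_coordinate.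
apply: finitely_lipschitzN; exact: finitely_lipschitz_coordinate.
Qed.

Lemma finite_change_bv0 (x y : RN) : (exists N, forall n, (N <= n)%N -> x n = y n) ->
  coset_rel (@bv0_infty R pr) (theta x) (theta y).
Proof.
move=> [N xy]; apply/theta_red/c0P => e e0; exists N => n /xy->.
by rewrite subrr normr0 ltW.
Qed.

Lemma bv0_fusion : exists (x : (nat -> bool) -> RN) (pos T : nat -> nat),
  [/\ {homo pos : i j / (i < j)%N}, {homo T : i j / (i < j)%N},
      forall a k, x a (pos k) = if a k then (letter k)%:R^-1 else 0,
      forall a b n, (forall k, n <> pos k) -> x a n = x b n &
      (forall k a b, (forall i, (k <= i)%N -> a i = b i) ->
         var_tail k (T k) (fun n => theta (x a) n - theta (x b) n)) /\
      (forall k a b, (forall i, (i < k)%N -> a i = b i) ->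
         var_head k (T k) (fun n => theta (x a) n - theta (x b) n))].
Proof.
apply: fusion => //.
- move=> x y /finite_change_bv0[/(bv_inftyP prK gK) bv _] k.
  have [N tail] := bounded_tail (fun n => normr_ge0 _) bv (pow_half_gt0 R k).
  by exists N => M; exact: tail.
- move=> k T T' TT' d tail M; apply: le_trans (tail M).
  exact: sum_nat_le.
- move=> k T d /existsNP[M /negP]; rewrite -ltNge => far.
  have lip : finitely_lipschitz (fun d => \sum_(T <= n < M) `|jmp d n|).
    by apply: finitely_lipschitz_sum => n; exact: finitely_lipschitz_jump.
  have [N [e [e0 Ne]]] := finitely_lipschitz_gt lip far.
  exists N, e; split=> // d' /Ne far' /(_ M).
  by rewrite leNgt far'.
- move=> k T; apply: finitely_lipschitz_near0; last exact: pow_half_gt0.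
    apply: finitely_lipschitzD; apply: finitely_lipschitz_sum => n.
      exact: finitely_lipschitz_jump.
    by apply: finitely_lipschitz_norm; exact: finitely_lipschitz_coordinate.
  by rewrite !big1 ?addr0 // => n _; rewrite ?/jmp ?/jump ?subrr normr0.
Qed.

Section tree.
Variables (x : (nat -> bool) -> RN) (pos T : nat -> nat).
Hypothesis pos_incr : {homo pos : i j / (i < j)%N}.
Hypothesis T_incr : {homo T : i j / (i < j)%N}.
Hypothesis x_pos : forall a k, x a (pos k) = if a k then (letter k)%:R^-1 else 0.
Hypothesis x_else : forall a b n, (forall k, n <> pos k) -> x a n = x b n.
Hypothesis x_tail : forall k a b, (forall i, (k <= i)%N -> a i = b i) ->
  var_tail k (T k) (fun n => theta (x a) n - theta (x b) n).
Hypothesis x_head : forall k a b, (forall i, (i < k)%N -> a i = b i) ->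
  var_head k (T k) (fun n => theta (x a) n - theta (x b) n).

Let dist a b i j :=
  \sum_(i <= n < j) `|jmp (fun n => theta (x a) n - theta (x b) n) n|.

Let jmpB a b n : jmp (fun n => theta (x a) n - theta (x b) n) n =
  jmp (theta (x a)) n - jmp (theta (x b)) n.
Proof. by rewrite /jmp /jump; ring. Qed.

Let dist_triangle a b c i j : dist a b i j <= dist a c i j + dist c b i j.
Proof.
rewrite /dist -big_split /=; apply: ler_sum => n _; rewrite !jmpB.
exact: ler_distD.
Qed.

Let dist_sym a b i j : dist a b i j = dist b a i j.
Proof. by apply: eq_bigr => n _; rewrite !jmpB distrC. Qed.

Let dist_refl a i j : dist a a i j = 0.
Proof. by rewrite /dist big1 // => n _; rewrite jmpB subrr normr0. Qed.

Let V k := dist (fun i => i == k) (fun=> false) (T k) (T k.+1).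

Let V_ge0 k : 0 <= V k. Proof. by apply: sumr_ge0. Qed.

Lemma dist_single k a : dist a (single k a) (T k) (T k.+1) <= 2 * pow_half R k.
Proof.
apply: le_trans (dist_triangle _ _ (upto k a) _ _) _.
have h1 : dist a (upto k a) (T k) (T k.+1) <= pow_half R k.
  apply: le_trans (pow_half_le R (leqnSn k)).
  apply: le_trans (x_head (@upto_agree k a)).
  apply: ler_wpDr; first exact: sumr_ge0.
  exact: sum_nat_le.
have h2 : dist (upto k a) (single k a) (T k) (T k.+1) <= pow_half R k.
  exact: (x_tail (@upto_single k a)).
by lra.
Qed.

Lemma dist_singles k a b :
  dist (single k a) (single k b) (T k) (T k.+1) = (a k != b k)%:R * V k.
Proof.
rewrite !singleE; case: (a k) (b k) => -[] /=;
  by rewrite ?dist_refl ?mul0r ?mul1r // dist_sym.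
Qed.

(** The bits above k act on the indices below [T k.+1] by little, and the bits
below k on the indices from [T k] on, so the variation between [T k] and [T k.+1]
is decided by the k-th bit. *)
Lemma window_le k a b :
  dist a b (T k) (T k.+1) <= (a k != b k)%:R * V k + 4 * pow_half R k.
Proof.
have h1 := dist_single k a; have h2 := dist_single k b.
have h3 := dist_triangle a b (single k a) (T k) (T k.+1).
have := dist_triangle (single k a) b (single k b) (T k) (T k.+1).
by rewrite dist_singles (dist_sym (single k b)) => h4; lra.
Qed.

Lemma window_ge k a b :
  (a k != b k)%:R * V k <= dist a b (T k) (T k.+1) + 4 * pow_half R k.
Proof.
have h1 := dist_single k a; have h2 := dist_single k b.
have h3 := dist_triangle (single k a) (single k b) a (T k) (T k.+1).
have := dist_triangle a (single k b) b (T k) (T k.+1).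
by move: h3; rewrite dist_singles (dist_sym (single k a)) => h3 h4; lra.
Qed.

Lemma theta_c0 a b : c0 (fun n => x a n - x b n) <->
  bv0_infty pr (fun n => theta (x a) n - theta (x b) n).
Proof. exact: theta_red. Qed.

(** If every letter cost infinite variation, then finite blocks of positions with
letters tending to infinity could be chosen so as to cost variation at least 1
each: a null difference with image of unbounded variation. *)
Lemma cheap_letter : exists2 i, (0 < i)%N &
  exists M, forall n, \sum_(0 <= k < n) (letter k == i)%:R * V k <= M.
Proof.
apply: contrapT => no.
have block i s : exists t, (s < t)%N /\
    1 <= \sum_(s <= k < t) (letter k == i.+1)%:R * V k.
  apply: contrapT => nt; apply: no; exists i.+1 => //.
  exists (\sum_(0 <= k < s.+1) (letter k == i.+1)%:R * V k + 1) => n.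
  have V'_ge0 k : 0 <= (letter k == i.+1)%:R * V k by rewrite mulr_ge0.
  have [ns|sn] := leqP n s.+1.
    by apply: ler_wpDr => //; exact: sum_nat_le.
  rewrite (@big_cat_nat _ _ _ s.+1 0 n) //=; last exact: ltnW.
  rewrite lerD2l; apply: le_trans (sum_nat_le V'_ge0 (leqnSn s) (leqnn n)) _.
  rewrite leNgt; apply/negP => big; apply: nt; exists n; split; last exact: ltW.
  exact: ltnW.
have [nxt nxtP] := choice (fun p : nat * nat => block p.1 p.2).
pose s := fix s i := if i is j.+1 then nxt (j, s j) else 0%N.
have s_incr : {homo s : i j / (i < j)%N}.
  by apply: homo_ltn; [exact: ltn_trans|move=> i; have [h _] := nxtP (i, s i)].
pose a k := `[< exists i, (s i <= k < s i.+1)%N /\ letter k = i.+1 >].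
have [|/(bv_inftyP prK gK)[M bounded] _] := (theta_c0 a (fun=> false)).1.
  apply/c0P => e e0.
  have [i _ ie] := @near_infty_natSinv_lt R (PosNum e0).
  exists (pos (s i)) => n sn.
  have [[k nk]|nk] := pselect (exists k, n = pos k); last first.
    rewrite (x_else _ (fun=> false)) ?subrr ?normr0 ?ltW // => k e1.
    by apply: nk; exists k.
  rewrite nk !x_pos subr0 /a; case: asboolP => [|_]; last by rewrite normr0 ltW.
  move=> [j [/andP[sk ks] ->]]; rewrite ger0_norm ?invr_ge0 //; apply: ltW; apply: ie.
  rewrite /= leqNgt; apply/negP => ji.
  have := pos_incr (leq_trans ks (homo_ltn_leq s_incr ji)).
  by rewrite -nk ltnNge sn.
have cost i : i%:R <= \sum_(0 <= k < s i) (a k != false)%:R * V k.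
  elim: i => [|i IHi]; first by rewrite big_geq.
  have si : (s i <= s i.+1)%N by exact/ltnW/s_incr.
  rewrite (big_cat_nat (leq0n (s i)) si) /= -natr1 lerD //.
  have [_ h] := nxtP (i, s i); apply: le_trans h _.
  rewrite /= [leRHS]big_nat_cond [leLHS]big_nat_cond; apply: ler_sum => k.
  rewrite andbT => ks; apply: ler_wpM2r => //; rewrite ler_nat.
  case: eqP => [ck|//]; suff -> : a k by [].
  by apply/asboolP; exists i.
(* The errors [4 * pow_half k] in the windows add up to at most 8. *)
have [i iM] : exists i : nat, M + 8 < i%:R.
  by exists (Num.truncn (M + 8)).+1; exact: truncnS_gt.
have : \sum_(0 <= k < s i) (a k != false)%:R * V k <=
    \sum_(0 <= k < s i) (dist a (fun=> false) (T k) (T k.+1) + 4 * pow_half R k).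
  by apply: ler_sum => k _; exact: window_ge.
rewrite big_split /= -mulr_sumr -(sum_blocks _ T_incr) // => h1.
have h2 := pow_half_sum_le R 0 (s i).
have h3 := bounded (T (s i)).
have h4 : dist a (fun=> false) (T 0%N) (T (s i)) <= dist a (fun=> false) 0 (T (s i)).
  exact: sum_nat_le.
have h5 := cost i.
have h6 : pow_half R 0 = 1 by rewrite /pow_half expr0.
by move: h4; rewrite /dist => h4; rewrite h6 in h2; lra.
Qed.

(** All the bits of the cheap letter are flipped; by [dist_cut], the variation due
to the bits from k on tends to 0 as k grows. *)
Lemma tree_contradiction : False.
Proof.
have [i i_gt0 cheap] := cheap_letter.
pose a k := letter k == i.
pose D b n : R := theta (x a) n - theta (x b) n.
have aV_ge0 k : 0 <= (a k)%:R * V k by rewrite mulr_ge0.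
have dist_cut k n : dist a (fun j => (j < k)%N && a j) 0 n <=
    pow_half R k + (\sum_(k <= l < n) (a l)%:R * V l + 8 * pow_half R k).
  have Tn : (n <= T (maxn k n))%N.
    by apply: leq_trans (leq_maxr k n) _; exact: homo_ltn_id.
  apply: (@le_trans _ _ (dist a (fun j => (j < k)%N && a j) 0 (T (maxn k n)))).
    exact: sum_nat_le.
  rewrite /dist (@big_cat_nat _ _ _ (T k)) //=; last first.
    by apply: homo_ltn_leq T_incr _ _ _; exact: leq_maxl.
  apply: lerD.
    have agree j : (j < k)%N -> a j = (j < k)%N && a j by move=> ->.
    apply: le_trans (x_head agree).
    by apply: ler_wpDr => //; exact: sumr_ge0.
  rewrite sum_blocks //; last exact: leq_maxl.
  have -> : \sum_(k <= l < n) (a l)%:R * V l = \sum_(k <= l < maxn k n) (a l)%:R * V l.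
    rewrite maxnE; case: (leqP k n) => kn; first by rewrite subnKC.
    by rewrite (eqP (ltnW kn)) addn0 !big_geq // ltnW.
  apply: (@le_trans _ _ (\sum_(k <= l < maxn k n) ((a l)%:R * V l + 4 * pow_half R l))).
    rewrite [leRHS]big_nat_cond [leLHS]big_nat_cond; apply: ler_sum => l.
    rewrite andbT => /andP[kl _]; apply: le_trans (window_le _ _ _) _.
    by rewrite ltnNge kl /= lerD2r; case: (a l).
  rewrite big_split /= lerD2l -mulr_sumr.
  by have := pow_half_sum_le R k (maxn k n); lra.
have not_c0 : ~ c0 (fun n => x a n - x (fun=> false) n).
  move=> /c0P/(_ (i%:R^-1 / 2)).
  have i0 : 0 < i%:R^-1 :> R by rewrite invr_gt0 ltr0n.
  rewrite divr_gt0 // => /(_ isT)[N /(_ (pos (pr (i, N))))].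
  have NN : (N <= pos (pr (i, N)))%N.
    by apply: leq_trans (homo_ltn_id pos_incr _); exact: (homo_ltn_id (@pr_incr i)).
  move=> /(_ NN); rewrite !x_pos /a /letter prK /= eqxx subr0 ger0_norm ?(ltW i0) // => h.
  by lra.
apply/not_c0/theta_c0.
have bvD : bv_infty pr (fun n => theta (x a) n - theta (x (fun=> false)) n).
  apply/(bv_inftyP prK gK); have [M cheapM] := cheap.
  exists (pow_half R 0 + (M + 8 * pow_half R 0)) => n.
  have := dist_cut 0%N n.
  rewrite (_ : (fun j => _) = (fun=> false)); last by apply/funext.
  by move=> h; apply: le_trans h _; rewrite lerD2l lerD2r; exact: cheapM.
split=> //; apply: (bv_rows_c0 prK gK pr_incr bvD) => r e e0.
have e40 : 0 < e / 4 by rewrite divr_gt0.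
have [N1 tail] := bounded_tail aV_ge0 cheap e40.
(* 9 = 1 + 8, the errors at k in [dist_cut]. *)
have [N2 small] := pow_half_small (divr_gt0 e40 (ltr0n _ 9)).
pose k := maxn (maxn N1 N2) (pr (r, 0%N)).+1.
pose b j := (j < k)%N && a j.
have cut n : dist a b 0 n <= e / 2.
  apply: le_trans (dist_cut k n) _.
  have h1 : \sum_(k <= l < n) (a l)%:R * V l <= e / 4 by apply: tail; rewrite /k; lia.
  have h2 : pow_half R k <= pow_half R N2 by apply: pow_half_le; rewrite /k; lia.
  by lra.
have head : `|D b (pr (r, 0%N))| <= e / 4.
  have agree j : (j < k)%N -> a j = b j by rewrite /b => ->.
  have h0 : pow_half R k <= pow_half R N2 by apply: pow_half_le; rewrite /k; lia.
  have h1 := x_head agree; rewrite /var_head /= in h1.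
  have h2 : 0 <= \sum_(0 <= n < T k) `|jmp (D b) n| by exact: sumr_ge0.
  have rk : (pr (r, 0%N) < k)%N by rewrite /k; lia.
  have := sum_nat_le (fun n => normr_ge0 (D b n)) (leq0n (pr (r, 0%N))) rk.
  rewrite big_nat1 => h3; move: h1 h2 h3; rewrite /D => h1 h2 h3; lra.
have [_ /c0P/(_ _ e40)[N bN]] :
    bv0_infty pr (fun n => theta (x b) n - theta (x (fun=> false)) n).
  apply: finite_change_bv0; exists (pos k) => n kn.
  have [[l nl]|nl] := pselect (exists l, n = pos l); last first.
    by apply: x_else => l e1; apply: nl; exists l.
  rewrite nl !x_pos /b; suff -> : (l < k)%N = false by [].
  by apply/negbTE; rewrite -leqNgt leqNgt; apply/negP => /pos_incr; rewrite -nl ltnNge kn.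
exists N => j Nj.
have h1 := row_variation prK pr_incr (D b) r (leq0n j).
have h2 := cut (pr (r, j)).
have h3 : \sum_(pr (r, 0%N) <= n < pr (r, j)) `|jmp (D b) n| <= dist a b 0 (pr (r, j)).
  exact: sum_nat_le.
have Nprj : (N <= pr (r, j))%N.
  by apply: leq_trans Nj _; exact: (homo_ltn_id (@pr_incr r)).
have h4 := bN _ Nprj.
have h5 := ler_distD (theta (x b) (pr (r, j))) (theta (x a) (pr (r, j)))
  (theta (x (fun=> false)) (pr (r, j))).
have h7 := ler_distD (D b (pr (r, 0%N))) (D b (pr (r, j))) 0.
rewrite !subr0 (distrC (D b (pr (r, j)))) in h7.
apply: le_trans h5 _; rewrite -/(D b (pr (r, j))).
by move: h1 h2 h3 h4 head h7; rewrite /jmp => h1 h2 h3 h4 h5 h6; lra.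
Qed.

End tree.

Lemma no_c0_reduction_to_bv0 : False.
Proof.
have [x [pos [T [pos_incr T_incr x_pos x_else [x_tail x_head]]]]] := bv0_fusion.
exact: (tree_contradiction pos_incr T_incr x_pos x_else x_tail x_head).
Qed.

End no_reduction_to_bv0.

(** * Absolutely summable sequences do not reduce to convergent series *)

Lemma pigeonhole (K : finType) (h : nat -> K) : exists t t', (t < t')%N /\ h t = h t'.
Proof.
apply: contrapT => no.
have inj : injective (fun t : 'I_(#|K|.+1) => h t).
  move=> t t' htt'; apply: val_inj; case: (ltngtP t t') => // lt; case: no.
    by exists t, t'.
  by exists t', t.
by have := leq_card _ inj; rewrite card_ord ltnn.
Qed.

(** The cube is divided into finitely many cells of side e. *)
Lemma close_pair (R : realType) (I : finType) (u : I -> nat -> R) (e : R) :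
    0 < e -> (forall i t, `|u i t| <= 1) ->
  exists t t', (t < t')%N /\ forall i, `|u i t - u i t'| <= e.
Proof.
move=> e0 u1; pose B := Num.truncn (2 / e).
have cell_ge0 i t : 0 <= (u i t + 1) / e.
  by apply: divr_ge0; [have := u1 i t; rewrite ler_norml => /andP[]; lra|exact: ltW].
have cell_lt i t : (Num.truncn ((u i t + 1) / e) < B.+1)%N.
  rewrite ltnS /B; apply: le_truncn; rewrite ler_pM2r ?invr_gt0 //.
  by have := u1 i t; rewrite ler_norml => /andP[]; lra.
have [t [t' [tt' same]]] :=
  pigeonhole (fun t => [ffun i : I => Ordinal (cell_lt i t)]).
exists t, t'; split=> // i.
have /(congr1 val) /= cell : Ordinal (cell_lt i t) = Ordinal (cell_lt i t').
  by have := congr1 (fun f : {ffun I -> 'I_B.+1} => f i) same; rewrite !ffunE.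
have /andP[l1 r1] := truncn_itv (cell_ge0 i t).
have /andP[l2 r2] := truncn_itv (cell_ge0 i t').
rewrite cell in l1 r1; rewrite -natr1 in r1 r2.
have : `|(u i t + 1) / e - (u i t' + 1) / e| <= 1.
  by rewrite ler_norml; apply/andP; split; lra.
rewrite -mulrBl (_ : u i t + 1 - (u i t' + 1) = u i t - u i t'); last by ring.
by rewrite normrM normfV (gtr0_norm e0) ler_pdivrMr // mul1r.
Qed.

Lemma between_terms (q : nat -> nat) j0 J : {homo q : i j / (i < j)%N} ->
  (q j0 <= J)%N -> exists j, [/\ (j0 <= j)%N, (q j <= J)%N & (J < q j.+1)%N].
Proof.
move=> q_incr qJ; have ex : exists j, (q j <= J)%N by exists j0.
have bound j : (q j <= J)%N -> (j <= J)%N by apply: leq_trans; exact: homo_ltn_id.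
have [j jJ max_j] := ex_maxnP ex bound; exists j; split=> //; first exact: max_j.
by rewrite ltnNge; apply/negP => /max_j; rewrite ltnn.
Qed.

Lemma shifted_harmonic_unbounded (R : realType) N :
  ~ exists M, forall n, \sum_(0 <= j < n) (N + j).+1%:R^-1 <= M :> R.
Proof.
move=> [M bound]; apply: (@dvg_harmonic R); apply: nondecreasing_is_cvgn.
  move=> i j ij; rewrite /series /= (big_cat_nat (leq0n i) ij) /= lerDl.
  by apply: sumr_ge0.
exists (\sum_(0 <= j < N) harmonic j + M) => _ [n _ <-]; rewrite /series /=.
have h_ge0 k : 0 <= harmonic k :> R by rewrite /harmonic /=.
apply: le_trans (sum_nat_le h_ge0 (leqnn 0%N) (leq_addl N n)) _.
rewrite (big_cat_nat (leq0n N) (leq_addr n N)) /= lerD2l.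
rewrite -{1}[N]add0n big_addn addKn.
apply: le_trans (bound n); apply: ler_sum => j _.
by rewrite /harmonic /= addnC.
Qed.

Section no_reduction_to_cs.
Variables (R : realType) (pr : nat * nat -> nat) (g : nat -> nat * nat) (m : nat).
Local Notation RN := {ptws nat -> R}.
Hypothesis prK : cancel pr g.
Hypothesis pr_incr : forall i, {homo (fun j => pr (i, j)) : j k / (j < k)%N}.
Variable theta : RN -> RN.
Hypothesis borel_theta : borel_function theta.

Hypothesis theta_red : forall x y : RN,
  coset_rel (@l1 R) x y <-> coset_rel (@cs R m) (theta x) (theta y).

(* The positions [pr (i, j)] carry the letter i, so every letter occurs infinitely
   often. *)
Let letter n := (g n).1.

Let psum i J (d : nat -> R) : R := \sum_(0 <= j < J) d (m * j + i - 1)%N.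

Let osc_tail k T : set (nat -> R) := [set d | forall i J J', (1 <= i <= m)%N ->
  (T <= J)%N -> (T <= J')%N -> `|psum i J d - psum i J' d| <= pow_half R k].
Let sum_head k T : set (nat -> R) :=
  [set d | \sum_(0 <= i < m.+1) \sum_(0 <= J < T.+1) `|psum i J d| <= pow_half R k].

Lemma finitely_lipschitz_psum i J : finitely_lipschitz (psum i J).
Proof. by apply: finitely_lipschitz_sum => j; exact: finitely_lipschitz_coordinate. Qed.

Lemma psumB i J (d d' : nat -> R) :
  psum i J (fun n => d n - d' n) = psum i J d - psum i J d'.
Proof. by rewrite /psum -sumrB. Qed.

Lemma l1P (a : RN) : l1 a <-> exists M, forall n, \sum_(0 <= i < n) `|a i| <= M.
Proof. exact: nneseries_boundedP. Qed.

Lemma cs_uniform (d : RN) e : cs m d -> 0 < e -> exists N, forall i, (1 <= i <= m)%N ->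
  forall J J', (N <= J)%N -> (N <= J')%N -> `|psum i J d - psum i J' d| <= e.
Proof.
move=> csd e0; have e20 : 0 < e / 2 by rewrite divr_gt0.
have [|i|N [_ NP]] := @bound_all _ (fun i N => forall J J', (N <= J)%N -> (N <= J')%N ->
    `|psum i J d - psum i J' d| <= e) (iota 1 m) _ _ 0%N.
- by move=> i N N' NN' NP J J' NJ NJ'; apply: NP; exact: leq_trans NN' _.
- rewrite mem_iota add1n ltnS => im.
  have /cvgn_cauchyP/(_ _ e20)[N uN] := csd i im.
  exists N => J J' NJ NJ'; have h1 := uN _ NJ; have h2 := uN _ NJ'.
  rewrite distrC in h2; apply: le_trans (ler_distD (psum i N d) _ _) _.
  by rewrite [leRHS]splitr lerD.
by exists N => i im; apply: NP; rewrite mem_iota add1n ltnS.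
Qed.

Lemma finite_change_cs (x y : RN) : (exists N, forall n, (N <= n)%N -> x n = y n) ->
  cs m (fun n => theta x n - theta y n).
Proof.
move=> [N xy]; apply/theta_red/l1P.
exists (\sum_(0 <= i < N) `|x i - y i|) => n.
have [nN|/ltnW Nn] := leqP n N; first exact: sum_nat_le.
rewrite (big_cat_nat (leq0n N) Nn) /= [X in _ + X]big_nat_cond [X in _ + X]big1 ?addr0 //.
by move=> i; rewrite andbT => /andP[/xy-> _]; rewrite subrr normr0.
Qed.

Lemma cs_fusion : exists (x : (nat -> bool) -> RN) (pos T : nat -> nat),
  [/\ {homo pos : i j / (i < j)%N}, {homo T : i j / (i < j)%N},
      forall a k, x a (pos k) = if a k then (letter k)%:R^-1 else 0,
      forall a b n, (forall k, n <> pos k) -> x a n = x b n &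
      (forall k a b, (forall i, (k <= i)%N -> a i = b i) ->
         osc_tail k (T k) (fun n => theta (x a) n - theta (x b) n)) /\
      (forall k a b, (forall i, (i < k)%N -> a i = b i) ->
         sum_head k (T k) (fun n => theta (x a) n - theta (x b) n))].
Proof.
apply: fusion => //.
- move=> x y /finite_change_cs csxy k.
  have [N NP] := cs_uniform csxy (pow_half_gt0 R k).
  by exists N => i J J' im; exact: NP.
- move=> k T T' TT' d tail i J J' im TJ TJ'.
  by apply: tail => //; exact: leq_trans TT' _.
- move=> k T d /existsNP[i /existsNP[J /existsNP[J']]].
  move=> /not_implyP[im /not_implyP[TJ /not_implyP[TJ' /negP]]]; rewrite -ltNge => far.
  have lip : finitely_lipschitz (fun d => `|psum i J d - psum i J' d|).
    apply: finitely_lipschitz_norm; apply: finitely_lipschitzD.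
      exact: finitely_lipschitz_psum.
    by apply: finitely_lipschitzN; exact: finitely_lipschitz_psum.
  have [N [e [e0 Ne]]] := finitely_lipschitz_gt lip far.
  exists N, e; split=> // d' /Ne far' /(_ i J J' im TJ TJ').
  by rewrite leNgt far'.
- move=> k T; apply: finitely_lipschitz_near0; last exact: pow_half_gt0.
    do 2![apply: finitely_lipschitz_sum => ?].
    by apply: finitely_lipschitz_norm; exact: finitely_lipschitz_psum.
  by rewrite big1 // => i _; rewrite big1 // => J _; rewrite /psum big1 ?normr0.
Qed.

Section tree.
Variables (x : (nat -> bool) -> RN) (pos T : nat -> nat).
Hypothesis pos_incr : {homo pos : i j / (i < j)%N}.
Hypothesis T_incr : {homo T : i j / (i < j)%N}.
Hypothesis x_pos : forall a k, x a (pos k) = if a k then (letter k)%:R^-1 else 0.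
Hypothesis x_else : forall a b n, (forall k, n <> pos k) -> x a n = x b n.
Hypothesis x_tail : forall k a b, (forall i, (k <= i)%N -> a i = b i) ->
  osc_tail k (T k) (fun n => theta (x a) n - theta (x b) n).
Hypothesis x_head : forall k a b, (forall i, (i < k)%N -> a i = b i) ->
  sum_head k (T k) (fun n => theta (x a) n - theta (x b) n).

Let gap a b i J : R := psum i J (theta (x a)) - psum i J (theta (x b)).

Let gapE a b i J : psum i J (fun n => theta (x a) n - theta (x b) n) = gap a b i J.
Proof. exact: psumB. Qed.

Lemma gap_head k a b i J : (forall i, (i < k)%N -> a i = b i) ->
  (i <= m)%N -> (J <= T k)%N -> `|gap a b i J| <= pow_half R k.
Proof.
move=> ab im JT; apply: le_trans (x_head ab); rewrite -gapE.
have h1 := sum_nat_le (u := fun J => `|psum i J (fun n => theta (x a) n - theta (x b) n)|)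
  (fun=> normr_ge0 _) (leq0n J) (_ : J.+1 <= (T k).+1)%N.
have := sum_nat_le (u := fun i => \sum_(0 <= J < (T k).+1)
    `|psum i J (fun n => theta (x a) n - theta (x b) n)|)
  (fun=> sumr_ge0 _ (fun _ _ => normr_ge0 _)) (leq0n i) (_ : i.+1 <= m.+1)%N.
rewrite big_nat1 => h2; apply: le_trans (h2 im); apply: le_trans (h1 JT).
by rewrite big_nat1.
Qed.

Let osc a b i k J := gap a b i J - gap a b i (T k).

(* The effect of the k-th bit; its excursion is the size of w in the window, and
   its total effect the value of w at the end of the window. *)
Let w k i J := osc (fun i => i == k) (fun=> false) i k J.

Lemma osc_single k a i J : (1 <= i <= m)%N -> (T k <= J <= T k.+1)%N ->
  `|osc a (single k a) i k J| <= 2 * pow_half R k.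
Proof.
move=> /andP[i1 im] /andP[TJ JT].
have h1 := gap_head (@upto_agree k a) im JT.
have h2 := gap_head (@upto_agree k a) im (leq_trans TJ JT).
have := x_tail (@upto_single k a) (i := i) _ TJ (leqnn _).
rewrite !gapE i1 im => /(_ isT) h3.
have h4 := pow_halfS R k.
move: h1 h2 h3; rewrite /osc /gap !ler_norml.
by move=> /andP[? ?] /andP[? ?] /andP[? ?]; apply/andP; split; lra.
Qed.

Lemma osc_singles k a b i J :
  osc (single k a) (single k b) i k J = ((a k)%:R - (b k)%:R) * w k i J.
Proof.
rewrite !singleE /w /osc /gap; case: (a k) (b k) => -[] /=; ring.
Qed.

(** The bits above k move the partial sums up to [T k.+1] by little, and the bits
below k move those from [T k] on by nearly the same amount, so the oscillation
between [T k] and [T k.+1] is decided by the k-th bit. *)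
Lemma window k a b i J : (1 <= i <= m)%N -> (T k <= J <= T k.+1)%N ->
  `|osc a b i k J - ((a k)%:R - (b k)%:R) * w k i J| <= 4 * pow_half R k.
Proof.
move=> im kJ; have h1 := osc_single a im kJ; have h2 := osc_single b im kJ.
rewrite -osc_singles; move: h1 h2; rewrite /osc /gap !ler_norml.
by move=> /andP[? ?] /andP[? ?]; apply/andP; split; lra.
Qed.

Lemma theta_cs a b : l1 (fun n => x a n - x b n) <->
  cs m (fun n => theta (x a) n - theta (x b) n).
Proof. exact: theta_red. Qed.

(** Otherwise the positions of a summable family of letters would all have
excursions of a fixed size, so that a summable difference would have a divergent
image. *)
Lemma small_excursions e : 0 < e -> exists N, forall k i J,
  (N <= k)%N -> (N <= letter k)%N -> (1 <= i <= m)%N -> (T k <= J <= T k.+1)%N ->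
  `|w k i J| <= e.
Proof.
move=> e0; apply: contrapT => no.
have bad N : exists k, [/\ (N <= k)%N, (N <= letter k)%N & exists i J,
    [/\ (1 <= i <= m)%N, (T k <= J <= T k.+1)%N & e < `|w k i J|]].
  apply: contrapT => nk; apply: no; exists N => k i J Nk Nl im kJ.
  rewrite leNgt; apply/negP => far; apply: nk; exists k; split=> //.
  by exists i, J.
have [f fP] := choice bad.
(* The j-th bad position carries a letter from 2 ^ j on, which makes the letters
   summable, and lies beyond the previous one. *)
pose nn := fix nn j := if j is i.+1 then maxn (f (nn i)).+1 (2 ^ i.+1) else 1%N.
pose kk j := f (nn j).
have nn_ge j : (2 ^ j <= nn j)%N by case: j => //= j; rewrite leq_maxr.
have kk_incr : {homo kk : i j / (i < j)%N}.
  apply: homo_ltn; first exact: ltn_trans.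
  move=> j; have [h _ _] := fP (nn j.+1); apply: leq_trans h.
  by rewrite /= leq_max leqnn.
pose a k := `[< exists j, k = kk j >].
have kk_a j : a (kk j) by apply/asboolP; exists j.
have /theta_cs csD : l1 (fun n => x a n - x (fun=> false) n).
  apply/l1P; exists (2 * pow_half R 0) => n.
  pose u n := `|x a n - x (fun=> false) n|.
  have u_pos k : u (pos k) = if a k then (letter k)%:R^-1 else 0.
    rewrite /u !x_pos subr0; case: (a k); last by rewrite normr0.
    by rewrite ger0_norm ?invr_ge0.
  have u_ge0 k : 0 <= u k by exact: normr_ge0.
  apply: le_trans (sum_subseq_ge (u := u) (p := pos) n u_ge0 pos_incr _) _.
    by move=> j jpos; rewrite /u (x_else _ (fun=> false) jpos) subrr normr0.
  apply: le_trans (sum_subseq_ge (u := fun k => u (pos k)) (p := kk) n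
    (fun k => u_ge0 (pos k)) kk_incr _) _.
    move=> k knot; rewrite u_pos; suff /negbTE-> : ~~ a k by [].
    by apply/asboolPn => -[j kj]; exact: (knot j).
  apply: le_trans (pow_half_sum_le R 0 n); apply: ler_sum => j _.
  rewrite u_pos kk_a /pow_half exprVn lef_pV2 ?posrE ?exprn_gt0 ?ltr0n //; last first.
    have [_ h _] := fP (nn j); apply: leq_trans h; apply: leq_trans (nn_ge j).
    by rewrite expn_gt0.
  rewrite -natrX ler_nat; have [_ h _] := fP (nn j).
  exact: leq_trans (nn_ge j) h.
have e40 : 0 < e / 4 by rewrite divr_gt0.
have [N NP] := cs_uniform csD e40.
have [N' small] := pow_half_small (divr_gt0 e40 (ltr0n R 4)).
pose j := maxn N N'.
have [_ _ [i [J [im kJ far]]]] := fP (nn j).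
have jk : (j <= kk j)%N by exact: homo_ltn_id.
have NT : (N <= T (kk j))%N.
  apply: leq_trans (homo_ltn_id T_incr _); apply: leq_trans jk; exact: leq_maxl.
have h1 := window a (fun=> false) im kJ.
have h2 := NP i im J (T (kk j)) (leq_trans NT (proj1 (andP kJ))) NT.
have h3 : pow_half R (kk j) <= pow_half R N'.
  by apply: pow_half_le; apply: leq_trans jk; exact: leq_maxr.
rewrite !gapE in h2; rewrite -/(kk j) kk_a subr0 mul1r in h1.
rewrite -/(kk j) in far.
have := ler_distD (osc a (fun=> false) i (kk j) J) (w (kk j) i J) 0.
rewrite !subr0 (distrC (w _ _ _)) => h4.
by move: h1 h2 h4; rewrite /osc => h1 h2 h4; lra.
Qed.

(** The errors in the windows from u to v are [4 * pow_half l]; the bound is their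
sum in closed form. *)
Lemma equal_bits_gap a b i u v J : (1 <= i <= m)%N -> (u <= v)%N ->
    (forall l, (u <= l < v)%N -> a l = b l) -> (T u <= J <= T v)%N ->
  `|gap a b i J - gap a b i (T u)| <= 8 * (pow_half R u - pow_half R v).
Proof.
move=> im; elim: v J => [|v IHv] J.
  rewrite leqn0 => /eqP-> _; rewrite -eqn_leq => /eqP->.
  by rewrite !subrr normr0 mulr0.
rewrite leq_eqVlt => /predU1P[->|].
  by move=> _; rewrite -eqn_leq => /eqP->; rewrite !subrr normr0 mulr0.
rewrite ltnS => uv ab /andP[uJ Jv].
have IH J' := IHv J' uv.
have {}IH J' : (T u <= J' <= T v)%N ->
    `|gap a b i J' - gap a b i (T u)| <= 8 * (pow_half R u - pow_half R v).
  by apply: IH => l /andP[ul lv]; apply: ab; rewrite ul ltnW.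
have h0 := pow_halfS R v; have h1 := pow_half_gt0 R v.+1.
have [JTv|TvJ] := leqP J (T v).
  by have := IH J; rewrite uJ JTv => /(_ isT) h; lra.
have := window a b im (_ : (T v <= J <= T v.+1)%N); rewrite (ltnW TvJ) Jv => /(_ isT).
rewrite (ab v) ?uv ?ltnSn // subrr mul0r subr0 => h2.
have := IH (T v); rewrite leqnn (homo_ltn_leq T_incr uv) => /(_ isT) h3.
have := ler_distD (gap a b i (T v)) (gap a b i J) (gap a b i (T u)).
by move: h2; rewrite /osc => h2 h4; lra.
Qed.

(** Positions of one far letter have total effects in a cube of dimension m, by
[small_excursions], so two of them are close. *)
Lemma twin_positions : exists N, forall j s, exists kl : nat * nat,
  [/\ (maxn N s <= kl.1)%N, (kl.1 < kl.2)%N,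
      letter kl.1 = (N + j).+1, letter kl.2 = (N + j).+1 &
      forall i, (1 <= i <= m)%N ->
        `|w kl.1 i (T kl.1.+1) - w kl.2 i (T kl.2.+1)| <= pow_half R j].
Proof.
have [N NP] := small_excursions (@ltr01 R); exists N => j s.
pose pos_of t := pr ((N + j).+1, (maxn N s + t)%N).
have pos_ge t : (maxn N s <= pos_of t)%N.
  apply: leq_trans (leq_addr t _) _; exact: (homo_ltn_id (@pr_incr _)).
have letter_pos t : letter (pos_of t) = (N + j).+1 by rewrite /letter prK.
have effect_le1 (i : 'I_m) t : `|w (pos_of t) i.+1 (T (pos_of t).+1)| <= 1.
  apply: NP; rewrite ?letter_pos ?ltn_ord //.
  - by apply: leq_trans (pos_ge t); exact: leq_maxl.
  - by lia.
  - by rewrite leqnn (ltnW (T_incr (ltnSn _))).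
have [t [t' [tt' close]]] := close_pair (pow_half_gt0 R j) effect_le1.
exists (pos_of t, pos_of t'); split; rewrite ?letter_pos //=.
  by apply: pr_incr; rewrite ltn_add2l.
move=> [//|i] /andP[_ im]; exact: (close (Ordinal im)).
Qed.

(** The twins number j are [ka j < la j], and they lie before [ka j.+1]. Between
[ka j] and [ka j.+1] the partial sums move by two excursions and, in total, by the
difference of the twins' effects, up to an error of order 2^-j ([block_moves]).
So the partial sums satisfy Cauchy's criterion. *)
Lemma cs_tree_contradiction : False.
Proof.
have [N twins] := twin_positions.
have [nxt nxtP] := choice (fun p : nat * nat => twins p.1 p.2).
pose st := fix st j := if j is i.+1 then (nxt (i, st i)).2.+1 else 0%N.
pose ka j := (nxt (j, st j)).1; pose la j := (nxt (j, st j)).2.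
have kl j : (ka j < la j)%N by have [_ h _ _ _] := nxtP (j, st j).
have lk j : (la j < ka j.+1)%N.
  by have [h _ _ _ _] := nxtP (j.+1, st j.+1); apply: leq_trans h; exact: leq_maxr.
have ka_incr : {homo ka : i j / (i < j)%N}.
  by apply: homo_ltn; [exact: ltn_trans|move=> j; exact: ltn_trans (lk j)].
pose a k := `[< exists j, k = ka j >]; pose b k := `[< exists j, k = la j >].
have block j j' k : (ka j <= k < ka j.+1)%N -> (ka j' <= k < ka j'.+1)%N -> j = j'.
  move=> /andP[h1 h2] /andP[h3 h4]; case: (ltngtP j j') => // jj.
    by have := homo_ltn_leq ka_incr jj; lia.
  by have := homo_ltn_leq ka_incr jj; lia.
have aE j k : (ka j <= k < ka j.+1)%N -> a k = (k == ka j).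
  move=> jk; apply/asboolP/eqP => [[j' kj']|->]; last by exists j.
  by rewrite kj'; congr ka; apply/esym/(block _ _ _ jk); rewrite kj' leqnn ka_incr.
have bE j k : (ka j <= k < ka j.+1)%N -> b k = (k == la j).
  move=> jk; apply/asboolP/eqP => [[j' kj']|->]; last by exists j.
  by rewrite kj'; congr la; apply/esym/(block _ _ _ jk); rewrite kj' lk (ltnW (kl j')).
pose e i J := gap a b i J.
have block_moves j i J c : (1 <= i <= m)%N -> (T (ka j) <= J <= T (ka j.+1))%N ->
    (forall J', (T (ka j) <= J' <= T (ka j).+1)%N -> `|w (ka j) i J'| <= c) ->
    (forall J', (T (la j) <= J' <= T (la j).+1)%N -> `|w (la j) i J'| <= c) ->
    `|e i J - e i (T (ka j))| <= 2 * c + 8 * pow_half R (ka j) /\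
    `|e i (T (ka j.+1)) - e i (T (ka j))| <= pow_half R j + 8 * pow_half R (ka j).
  move=> im /andP[kJ Ju] wk_le wl_le.
  have c_ge0 : 0 <= c.
    by apply: le_trans (wk_le (T (ka j)) _); rewrite ?leqnn ?(ltnW (T_incr _)).
  have kaj : (ka j <= ka j < ka j.+1)%N by rewrite leqnn ka_incr.
  have laj : (ka j <= la j < ka j.+1)%N by rewrite (ltnW (kl j)) lk.
  have win_k J' (J'k : (T (ka j) <= J' <= T (ka j).+1)%N) :
      `|e i J' - e i (T (ka j)) - w (ka j) i J'| <= 4 * pow_half R (ka j).
    have := window a b im J'k.
    by rewrite (aE _ _ kaj) (bE _ _ kaj) eqxx (ltn_eqF (kl j)) subr0 mul1r.
  have win_l J' (J'l : (T (la j) <= J' <= T (la j).+1)%N) :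
      `|e i J' - e i (T (la j)) + w (la j) i J'| <= 4 * pow_half R (la j).
    have := window a b im J'l.
    by rewrite (aE _ _ laj) (bE _ _ laj) eqxx (gtn_eqF (kl j)) sub0r mulN1r opprK.
  have flat_kl J' (J'g : (T (ka j).+1 <= J' <= T (la j))%N) :
      `|e i J' - e i (T (ka j).+1)| <= 8 * (pow_half R (ka j).+1 - pow_half R (la j)).
    apply: equal_bits_gap => // l /andP[kal lla].
    have jl : (ka j <= l < ka j.+1)%N by rewrite (ltnW kal) (ltn_trans lla (lk j)).
    by rewrite (aE _ _ jl) (bE _ _ jl) (gtn_eqF kal) (ltn_eqF lla).
  have flat_lu J' (J'g : (T (la j).+1 <= J' <= T (ka j.+1))%N) :
      `|e i J' - e i (T (la j).+1)| <= 8 * (pow_half R (la j).+1 - pow_half R (ka j.+1)).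
    apply: equal_bits_gap => // l /andP[lal lka].
    have kal : (ka j < l)%N := ltn_trans (kl j) lal.
    have jl : (ka j <= l < ka j.+1)%N by rewrite (ltnW kal).
    by rewrite (aE _ _ jl) (bE _ _ jl) (gtn_eqF kal) (gtn_eqF lal).
  have := pow_halfS R (ka j); have := pow_halfS R (la j).
  have := pow_half_gt0 R (ka j.+1); have := pow_half_gt0 R (la j).
  have := pow_half_gt0 R (la j).+1.
  have := pow_half_le R (kl j); have := pow_half_le R (lk j).
  move=> p1 p2 p3 p4 p5 p6 p7.
  have T1 : (T (ka j) <= T (ka j).+1)%N by exact/ltnW/T_incr.
  have T2 : (T (ka j).+1 <= T (la j))%N := homo_ltn_leq T_incr (kl j).
  have T3 : (T (la j) <= T (la j).+1)%N by exact/ltnW/T_incr.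
  have T4 : (T (la j).+1 <= T (ka j.+1))%N := homo_ltn_leq T_incr (lk j).
  have k1 := win_k (T (ka j).+1) (introT andP (conj T1 (leqnn _))).
  have k2 := flat_kl (T (la j)) (introT andP (conj T2 (leqnn _))).
  have k3 := win_l (T (la j).+1) (introT andP (conj T3 (leqnn _))).
  have k4 := flat_lu (T (ka j.+1)) (introT andP (conj T4 (leqnn _))).
  have w1 := wk_le (T (ka j).+1) (introT andP (conj T1 (leqnn _))).
  have w2 := wl_le (T (la j).+1) (introT andP (conj T3 (leqnn _))).
  have [_ _ _ _ /(_ i im) twin] := nxtP (j, st j); rewrite /= -/(ka j) -/(la j) in twin.
  move: k1 k2 k3 k4 w1 w2 twin; rewrite !ler_norml.
  move=> /andP[? ?] /andP[? ?] /andP[? ?] /andP[? ?] /andP[? ?] /andP[? ?] /andP[? ?].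
  split; last by apply/andP; split; lra.
  have [J1|/ltnW J1] := leqP J (T (ka j).+1).
    have := win_k J (introT andP (conj kJ J1)).
    have := wk_le J (introT andP (conj kJ J1)).
    by rewrite !ler_norml => /andP[? ?] /andP[? ?]; apply/andP; split; lra.
  have [J2|/ltnW J2] := leqP J (T (la j)).
    have := flat_kl J (introT andP (conj J1 J2)).
    by rewrite !ler_norml => /andP[? ?]; apply/andP; split; lra.
  have [J3|/ltnW J3] := leqP J (T (la j).+1).
    have := win_l J (introT andP (conj J2 J3)).
    have := wl_le J (introT andP (conj J2 J3)).
    by rewrite !ler_norml => /andP[? ?] /andP[? ?]; apply/andP; split; lra.
  have := flat_lu J (introT andP (conj J3 Ju)).
  by rewrite !ler_norml => /andP[? ?]; apply/andP; split; lra.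
have : cs m (fun n => theta (x a) n - theta (x b) n).
  move=> i im; apply/cvgn_cauchyP => eps eps0.
  have eps40 : 0 < eps / 4 by rewrite divr_gt0.
  have [N1 small] := small_excursions eps40.
  (* The total error is [26 * pow_half j0], that is 18 from the checkpoints and 8
     from the last block, and the excursions take the other half of eps. *)
  have [N2 tiny] := pow_half_small (divr_gt0 eps40 (ltr0n R 13)).
  pose j0 := maxn N1 N2.
  have ka_ge j : (j <= ka j)%N by exact: homo_ltn_id.
  have excursion j : (j0 <= j)%N ->
      (forall J', (T (ka j) <= J' <= T (ka j).+1)%N -> `|w (ka j) i J'| <= eps / 4) /\
      (forall J', (T (la j) <= J' <= T (la j).+1)%N -> `|w (la j) i J'| <= eps / 4).
    move=> jj0; have h := ka_ge j; have h' := kl j.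
    have [_ _ l1 l2 _] := nxtP (j, st j); rewrite /= -/(ka j) -/(la j) in l1 l2.
    by split=> J' kJ'; apply: small => //; rewrite ?l1 ?l2; move: jj0; rewrite /j0; lia.
  have checkpoints j : (j0 <= j)%N ->
      `|e i (T (ka j)) - e i (T (ka j0))| <= 18 * pow_half R j0 - 18 * pow_half R j.
    elim: j => [|j IHj]; first by rewrite leqn0 => /eqP->; rewrite !subrr normr0.
    rewrite leq_eqVlt => /predU1P[<-|]; first by rewrite !subrr normr0.
    rewrite ltnS => jj0; have := IHj jj0; have [e1 e2] := excursion j jj0.
    have Tj : (T (ka j) <= T (ka j) <= T (ka j.+1))%N.
      by rewrite leqnn; exact/ltnW/T_incr/ka_incr.
    have [_ h1] := block_moves j i _ _ im Tj e1 e2.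
    have h2 := pow_half_le R (ka_ge j); have h3 := pow_halfS R j; move=> h4.
    have := ler_distD (e i (T (ka j))) (e i (T (ka j.+1))) (e i (T (ka j0))).
    by move=> h5; lra.
  have Tka_incr : {homo (T \o ka) : i j / (i < j)%N} by move=> ? ? /ka_incr/T_incr.
  exists (T (ka j0)) => J j0J.
  have [j [jj0 jJ Jj]] := between_terms Tka_incr j0J.
  have [e1 e2] := excursion j jj0.
  have [h1 _] := block_moves j i J _ im (introT andP (conj jJ (ltnW Jj))) e1 e2.
  have h2 := checkpoints j jj0; have h3 := pow_half_le R (ka_ge j).
  have h4 := pow_half_gt0 R j; have h5 := pow_half_le R jj0.
  have h6 : pow_half R j0 <= pow_half R N2 by apply: pow_half_le; exact: leq_maxr.
  have := ler_distD (e i (T (ka j))) (e i J) (e i (T (ka j0))) => h7.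
  have -> : series (fun j => theta (x a) (m * j + i - 1)%N -
      theta (x b) (m * j + i - 1)%N) = e i by apply/funext => n; rewrite /e -gapE.
  by lra.
move=> /theta_cs/l1P[M bound]; apply: (@shifted_harmonic_unbounded R N).
exists M => n; apply: le_trans (bound (pos (ka n))).
have p_incr : {homo (pos \o ka) : i j / (i < j)%N}.
  by move=> i j /ka_incr/pos_incr.
apply: le_trans (sum_subseq_le (u := fun n => `|x a n - x b n|) n _ p_incr) => //.
apply: ler_sum => j _ /=; rewrite !x_pos.
have kaj : (ka j <= ka j < ka j.+1)%N by rewrite leqnn ka_incr.
rewrite (aE _ _ kaj) (bE _ _ kaj) eqxx (ltn_eqF (kl j)) subr0.
have [_ _ -> _ _] := nxtP (j, st j).
by rewrite ger0_norm.
Qed.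

End tree.

Lemma no_l1_reduction_to_cs : False.
Proof.
have [x [pos [T [pos_incr T_incr x_pos x_else [x_tail x_head]]]]] := cs_fusion.
exact: (cs_tree_contradiction pos_incr T_incr x_pos x_else x_tail x_head).
Qed.

End no_reduction_to_cs.

Theorem theorem5p11 (R : realType) (pr : nat * nat -> nat)
    (hpr : admissible_pairing pr) (m : nat) (hm : (1 <= m)%N) :
  [/\ ~ borel_reducible (coset_rel (@l1 R)) (coset_rel (@cs R m)),
      ~ borel_reducible (coset_rel (@c0 R)) (coset_rel (@bv0_infty R pr)) &
      strictly_borel_reducible (coset_rel (@bv0_infty R pr))
        (prod_rel (coset_rel (@l1 R)) (coset_rel (@c0 R)))].
Proof.
have [[g prK gK] pr_incr] := hpr.
have c0_bv0 : ~ borel_reducible (coset_rel (@c0 R)) (coset_rel (@bv0_infty R pr)).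
  move=> [theta borel_theta theta_red].
  exact: (no_c0_reduction_to_bv0 prK gK pr_incr borel_theta theta_red).
split=> //.
  move=> [theta borel_theta theta_red].
  exact: (no_l1_reduction_to_cs prK pr_incr borel_theta theta_red).
split; first exact: bv0_reducible.
by move=> /(borel_reducible_trans (c0_reducible_prod R)).
Qed.
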